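(* Let $(G_i,u_i,v_i)$, $i=1,\dots,\ell$, be twice-marked graphs, where $G_i$ has genus $g_i$ and $(G_i,u_i,v_i)$ has torsion order $k_i$, and suppose each $(G_i,u_i,v_i)$ has $k_i$-general transmission. Let $(G,u,v)=(G,u_1,v_\ell)$ be their iterated vertex gluing. (1) If $k_i> g_1+g_2+\cdots+g_i$ for all $i$, then the once-marked graph $(G,v)$ is Brill–Noether general. (2) If $k_i>\min\{g_1+\cdots+g_i,\ g_i+g_{i+1}+\cdots+g_\ell\}$ for all $i$, then $G$ is a Brill–Noether general graph.
   Context: A graph is a finite, connected, loopless multigraph (parallel edges allowed); its genus is $g=|E(G)|-|V(G)|+1$. A divisor on $G$ is an element of the free abelian group on $V(G)$; its degree is the sum of its coefficients, and it is effective if all coefficients are nonnegative. Firing a vertex $w$ subtracts $\mathrm{val}(w)$ chips from $w$ and adds to each other vertex $w'$ the number of edges joining $w$ and $w'$; two divisors are linearly equivalent ($D\sim D'$) if their difference is an integer combination of firing moves. $|D|$ denotes the set of effective divisors linearly equivalent to $D$. The rank $r(D)$ is $-1$ if $|D|=\emptyset$, and otherwise the largest $r\ge 0$ such that $|D-E|\ne\emptyset$ for every effective divisor $E$ of degree $r$. The canonical divisor is $K_G=\sum_w(\mathrm{val}(w)-2)w$. $\delta(P)$ is $1$ if $P$ holds and $0$ otherwise. A twice-marked graph $(G,u,v)$ is a graph with two chosen vertices; its torsion order is the least $k\ge1$ with $ku\sim kv$. A twist of $D$ is a divisor $D+au+bv$, $a,b\in\mathbb Z$. Set $\Delta(D)=r(D)-r(D-u)-r(D-v)+r(D-u-v)$.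 $D$ is submodular if $\Delta(D')\ge 0$ for every twist $D'$ of $D$. If $D$ is submodular, its transmission permutation $\tau^{u,v}_D$ is the unique bijection $\mathbb Z\to\mathbb Z$ with $\delta(\tau^{u,v}_D(b)=a)=\Delta(D+au-bv)$ for all $a,b\in\mathbb Z$ (it exists iff $D$ is submodular). For a bijection $\tau$, an inversion is a pair $(a,b)$ with $a<b$, $\tau(a)>\tau(b)$; inversions $(a,b),(a',b')$ are $k$-equivalent if $a-a'=b-b'\equiv 0\pmod k$; $\mathrm{inv}_k(\tau)$ is the number of $k$-equivalence classes of inversions. A genus-$g$ twice-marked graph has $k$-general transmission if $ku\sim kv$, every divisor is submodular, and $\mathrm{inv}_k(\tau^{u,v}_D)\le g$ for every divisor $D$. Vertex gluing: for twice-marked graphs $(G_1,u_1,v_1),(G_2,u_2,v_2)$, the vertex gluing is $(G,u_1,v_2)$ where $G$ is the disjoint union with $v_1$ identified with $u_2$; the iterated vertex gluing of $(G_i,u_i,v_i)_{1\le i\le\ell}$ is obtained by successively gluing on $(G_2,u_2,v_2),\dots,(G_\ell,u_\ell,v_\ell)$. A graph $G$ of genus $g$ is Brill–Noether general if for every divisor $D$ and every integer $r$ with $0\le r\le r(D)$, $\rho(g,r,\deg D)=g-(r+1)(g-\deg D+r)\ge0$. For a vertex $v$ and divisor $D$ on a genus-$g$ graph, let $s_i(D,v)=\min\{\ell\in\mathbb Z: r(D+\ell v)\ge i\}$ and $\lambda_i(D,v)=i-s_i(D,v)+g-\deg D$ for $i\ge0$; the Weierstrass partition is $\lambda(D,v)=(\lambda_0,\lambda_1,\dots)$,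 a nonincreasing sequence of nonnegative integers with finitely many nonzero, and $|\lambda(D,v)|=\sum_i\lambda_i(D,v)$. A once-marked graph $(G,v)$ of genus $g$ is Brill–Noether general if $|\lambda(D,v)|\le g$ for every divisor $D$. *)

(* Defs.v *)
From HB Require Import structures.
From mathcomp Require Import all_boot all_order all_algebra.
From Stdlib Require Import ClassicalEpsilon.
Set Implicit Arguments. Unset Strict Implicit. Unset Printing Implicit Defensive.
Import Order.TTheory GRing.Theory Num.Theory.
Local Open Scope ring_scope.

(* A (multi)graph: a finite vertex type and an edge-multiplicity function. *)
Record graph := Graph { gV : finType; gm : gV -> gV -> nat }.

Definition is_graph (G : graph) : Prop :=
  [/\ (forall x y : gV G, gm x y = gm y x),
      (forall x : gV G, gm x x = 0%N),
      (0 < #|gV G|)%N &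
      (forall x y : gV G, connect (fun a b => (0 < gm a b)%N) x y)].

Definition valence (G : graph) (w : gV G) : int :=
  (\sum_(w' : gV G) gm w w')%N%:Z.

(* |E| = (sum of all multiplicities)/2 ; genus = |E| - |V| + 1 *)
Definition genus (G : graph) : int :=
  ((\sum_(x : gV G) \sum_(y : gV G) gm x y) %/ 2)%N%:Z - (#|gV G|)%:Z + 1.

Definition divisor (G : graph) := gV G -> int.

Definition ddeg (G : graph) (D : divisor G) : int := \sum_(x : gV G) D x.

Definition effective (G : graph) (D : divisor G) : Prop := forall x, 0 <= D x.

Definition fire (G : graph) (w : gV G) : divisor G :=
  fun x => if x == w then - valence w else (gm w x)%:Z.

Definition lin_equiv (G : graph) (D D' : divisor G) : Prop :=
  exists c : gV G -> int, forall x, D x - D' x = \sum_(w : gV G) c w * fire w x.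

Definition chip (G : graph) (u : gV G) : divisor G :=
  fun x => if x == u then 1 else 0.

Definition twist (G : graph) (D : divisor G) (a : int) (u : gV G) (b : int) (v : gV G)
  : divisor G := fun x => D x + a * chip u x + b * chip v x.

Definition linsys_nonempty (G : graph) (D : divisor G) : Prop :=
  exists E : divisor G, effective E /\ lin_equiv E D.

Definition rank_ge (G : graph) (D : divisor G) (r : int) : Prop :=
  forall E : divisor G, effective E -> ddeg E = r ->
    linsys_nonempty (fun x => D x - E x).

Definition is_rank (G : graph) (D : divisor G) (r : int) : Prop :=
  (~ linsys_nonempty D /\ r = -1) \/
  (linsys_nonempty D /\ 0 <= r /\ rank_ge D r /\
     forall r', 0 <= r' -> rank_ge D r' -> r' <= r).

Definition grank (G : graph) (D : divisor G) : int :=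
  epsilon (inhabits 0) (is_rank D).

Definition Delta (G : graph) (u v : gV G) (D : divisor G) : int :=
  grank D - grank (twist D (-1) u 0 v) - grank (twist D 0 u (-1) v)
  + grank (twist D (-1) u (-1) v).

Definition submodular (G : graph) (u v : gV G) (D : divisor G) : Prop :=
  forall a b : int, 0 <= Delta u v (twist D a u b v).

Definition is_transmission (G : graph) (u v : gV G) (D : divisor G)
  (tau : int -> int) : Prop :=
  bijective tau /\
  forall a b : int, (if tau b == a then 1 else 0) = Delta u v (twist D a u (- b) v).

Definition inversion (tau : int -> int) (p : int * int) : bool :=
  (p.1 < p.2) && (tau p.2 < tau p.1).

Definition kequiv (k : nat) (p q : int * int) : bool :=
  (p.1 - q.1 == p.2 - q.2) && (k%:Z %| p.1 - q.1)%Z.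

(* inv_k(tau) <= g : there are no g+1 pairwise k-inequivalent inversions *)
Definition inv_le (tau : int -> int) (k : nat) (g : int) : Prop :=
  forall s : seq (int * int), all (inversion tau) s ->
    pairwise (fun p q => ~~ kequiv k p q) s -> (size s)%:Z <= g.

Record tmgraph := TMGraph { tg : graph; tu : gV tg; tv : gV tg }.

Definition kchip (G : graph) (k : nat) (u : gV G) : divisor G :=
  fun x => k%:Z * chip u x.

Definition torsion_order (T : tmgraph) (k : nat) : Prop :=
  [/\ (1 <= k)%N, lin_equiv (kchip k (tu T)) (kchip k (tv T)) &
      forall k' : nat, (1 <= k')%N -> (k' < k)%N ->
        ~ lin_equiv (kchip k' (tu T)) (kchip k' (tv T))].

Definition general_transmission (T : tmgraph) (k : nat) : Prop :=
  [/\ lin_equiv (kchip k (tu T)) (kchip k (tv T)),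
      (forall D : divisor (tg T), submodular (tu T) (tv T) D) &
      forall (D : divisor (tg T)) (tau : int -> int),
        is_transmission (tu T) (tv T) D tau -> inv_le tau k (genus (tg T))].

(* C = (G, u1, v2) is the vertex gluing of A = (G1,u1,v1) and B = (G2,u2,v2),
   described up to isomorphism by the two embeddings f : G1 -> G, h : G2 -> G *)
Definition is_vertex_gluing (A B C : tmgraph) : Prop :=
  exists (f : gV (tg A) -> gV (tg C)) (h : gV (tg B) -> gV (tg C)),
  injective f /\ injective h /\
  f (tv A) = h (tu B) /\
  (forall x y, f x = h y -> x = tv A) /\
  (forall z, (exists x, f x = z) \/ (exists y, h y = z)) /\
  (forall x x', gm (f x) (f x') = gm x x') /\
  (forall y y', gm (h y) (h y') = gm y y') /\
  (forall x y, x <> tv A -> y <> tu B ->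
      gm (f x) (h y) = 0%N /\ gm (h y) (f x) = 0%N) /\
  tu C = f (tu A) /\ tv C = h (tv B).

Definition bn_general (G : graph) : Prop :=
  forall (D : divisor G) (r : int), 0 <= r -> r <= grank D ->
    0 <= genus G - (r + 1) * (genus G - ddeg D + r).

Definition sidx (G : graph) (D : divisor G) (v : gV G) (i : nat) : int :=
  epsilon (inhabits 0) (fun l : int =>
    i%:Z <= grank (twist D l v 0 v) /\
    forall l' : int, i%:Z <= grank (twist D l' v 0 v) -> l <= l').

Definition wlambda (G : graph) (D : divisor G) (v : gV G) (i : nat) : int :=
  i%:Z - sidx D v i + genus G - ddeg D.

(* once-marked (G,v) BN general: |lambda(D,v)| <= g for all D; since the
   lambda_i are nonnegative, |lambda| <= g iff every partial sum is <= g *)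
Definition bn_general_marked (G : graph) (v : gV G) : Prop :=
  forall (D : divisor G) (N : nat), \sum_(i < N) wlambda D v i <= genus G.

(* Main.v *)
Require Import Defs.
From mathcomp Require Import all_boot all_order all_algebra.
From mathcomp Require Import zify ring.
From Stdlib Require Import Classical ClassicalEpsilon.
Import Order.TTheory GRing.Theory Num.Theory.
Local Open Scope ring_scope.

(** Write [R = r + 1]. For a twice-marked graph and a divisor [D], the function
    [t a b = R(D + a u - b v)] is the counting function [#{b' >= b : tau b' <= a}] of the
    transmission permutation, and for a once-marked graph [b |-> R(D - b v)] is the counting
    function of a Maya diagram, i.e. of a partition. Vertex gluing is bounded by the min-plus
    product [min_c (A c + t (c - 1) b)], so it acts on partitions. The permutation [tau]
    commutes with translation by the torsion order [k], hence can be peeled off one periodic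
    descent at a time, each descent lowering [inv_k] by one and adding boxes on the diagonals
    of one residue class modulo [k]. Two boxes addable on such diagonals bound a rim hook of
    [k - 1] boxes, so a partition with at most [k - 2] boxes gains at most one box per descent.
    Thus along the chain the [i]-th graph adds at most [g_i] boxes as long as
    [g_1 + ... + g_i < k_i]; this is part (1). For part (2), the chain is cut where the minimum
    switches sides: the two halves give partitions [lambda] and [mu] of total size at most [g]
    with [lambda_i + mu_(r-i) >= g - d + r] for [0 <= i <= r].

    Riemann-Roch is not needed: it suffices that some divisor of degree [g - 1] (that of an
    acyclic orientation) is unwinnable, so that [r(D) <= deg D - g] in large degree. *)

(** * Integers and Maya diagrams *)

Lemma dvdz_gap (k : nat) (a b : int) : (k%:Z %| a)%Z -> (k%:Z %| b)%Z -> a < b -> k%:Z <= b - a.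
Proof.
move=> ka kb lt_ab; have /dvdzP [q def_q] : (k%:Z %| b - a)%Z by rewrite rpredB.
have q_gt0 : 0 < q by nia.
nia.
Qed.

Lemma dvdz_succF (k : nat) (a i : int) : (1 < k)%N ->
  (k%:Z %| a - i)%Z -> (k%:Z %| a + 1 - i)%Z = false.
Proof.
move=> k_gt1 ka; apply/negP => ka1.
by have := dvdz_gap _ _ _ ka ka1; lia.
Qed.

Lemma dvdz_predF (k : nat) (a i : int) : (1 < k)%N ->
  (k%:Z %| a - i)%Z -> (k%:Z %| a - 1 - i)%Z = false.
Proof.
move=> k_gt1 ka; apply/negP => ka1.
by have := dvdz_gap _ _ _ ka1 ka; lia.
Qed.

Lemma int_least (P : int -> Prop) (z0 z1 : int) : P z1 -> (forall z : int, P z -> z0 <= z) ->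
  exists z : int, P z /\ forall y : int, P y -> z <= y.
Proof.
move=> Pz1 lbP; have [n le_n] : exists n : nat, z1 - z0 <= n%:Z by exists `|z1 - z0|%N; lia.
elim: n z1 Pz1 le_n => [|n IH] z1 Pz1 le_n.
  by exists z1; split=> // y /lbP; lia.
case: (classic (exists y, P y /\ y < z1)) => [[y [Py lt_y]]|no_y].
  by apply: (IH y Py); lia.
exists z1; split=> // y Py; case: (leP z1 y) => // lt_y.
by case: no_y; exists y.
Qed.

Lemma int_greatest (P : int -> Prop) (z0 z1 : int) : P z1 -> (forall z : int, P z -> z <= z0) ->
  exists z : int, P z /\ forall y : int, P y -> y <= z.
Proof.
move=> Pz1 ubP.
have [||z [Pz minz]] := @int_least (fun z => P (- z)) (- z0) (- z1).
- by rewrite opprK.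
- by move=> z /ubP; lia.
exists (- z); split=> // y Py.
by have := minz (- y); rewrite opprK => /(_ Py); lia.
Qed.

Lemma int_up_ind (P : int -> Prop) (z0 : int) :
  P z0 -> (forall z : int, z0 <= z -> P z -> P (z + 1)) ->
  forall z : int, z0 <= z -> P z.
Proof.
move=> P0 PS z le_z.
have -> : z = z0 + `|z - z0|%N%:Z by lia.
elim: `|z - z0|%N => [|n IH]; first by rewrite addr0.
have -> : z0 + n.+1%:Z = z0 + n%:Z + 1 by lia.
by apply: PS => //; lia.
Qed.

Lemma int_down_ind (P : int -> Prop) (z0 : int) :
  P z0 -> (forall z : int, z <= z0 -> P z -> P (z - 1)) ->
  forall z : int, z <= z0 -> P z.
Proof.
move=> P0 PS z le_z; rewrite -[z]opprK.
apply: (@int_up_ind (fun y => P (- y)) (- z0)); rewrite ?opprK //; last by lia.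
by move=> y le_y Py; rewrite opprD; apply: PS => //; lia.
Qed.

Lemma sum_indicator_ge (a p q : int) (L : nat) : a <= p ->
  Num.min q (a + L%:Z - 1) - p + 1 <= \sum_(j < L) (p <= a + j%:Z <= q)%R%:Z.
Proof.
move=> le_ap; elim: L => [|L IH]; first by rewrite big_ord0; lia.
have sum_ge0 : 0 <= \sum_(j < L) (p <= a + j%:Z <= q)%R%:Z by apply: sumr_ge0.
by rewrite big_ord_recr /=; set S := \sum_(_ < L) _ in IH sum_ge0 *; lia.
Qed.

Lemma sum_indicator_le (p q : int) (N : nat) : 0 <= p ->
  \sum_(i < N) (p <= i%:Z < q)%R%:Z <= Num.max 0 (Num.min q N%:Z - p).
Proof.
move=> p_ge0; elim: N => [|N IH]; first by rewrite big_ord0; lia.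
by rewrite big_ord_recr /=; set S := \sum_(_ < N) _ in IH *; lia.
Qed.

Lemma sum_le1 (N : nat) (F : nat -> int) :
  (forall j, 0 <= F j <= 1) ->
  (forall i j : nat, (i < j)%N -> F i = 1 -> F j = 1 -> False) ->
  \sum_(j < N) F j <= 1.
Proof.
move=> F01 Funiq.
elim: N => [|N IH]; first by rewrite big_ord0.
rewrite big_ord_recr /=.
case: (eqVneq (F N) 1) => [FN|FN]; last first.
  by have := F01 N; set S := \sum_(_ < N) _ in IH *; lia.
rewrite big1 ?FN // => j _.
have := Funiq _ _ (ltn_ord j); have := F01 j => Fj F1.
case: (eqVneq (F j) 0) => // Fj0; exfalso; apply: F1 => //; lia.
Qed.

(* The rank jumps of a once-marked graph form a partition of size [m]: [M b] stands for
   [r(D - b v) + 1], and the excess of [M] over its asymptotes sums to the number of boxes. *)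
Definition maya (M : int -> int) (chi m : int) : Prop :=
  [/\ forall b : int, 0 <= M b,
      forall b : int, chi - b <= M b,
      forall b : int, M (b + 1) <= M b <= M (b + 1) + 1 &
      forall (a : int) (N : nat),
        \sum_(j < N) (M (a + j%:Z) - Num.max 0 (chi - (a + j%:Z))) <= m].

Lemma maya_le (M : int -> int) (chi m m' : int) : m <= m' -> maya M chi m -> maya M chi m'.
Proof. by move=> le_m [? ? ? sz]; split=> // a N; apply: le_trans (sz a N) le_m. Qed.

Lemma maya_anti (M : int -> int) (chi m b c : int) : maya M chi m -> b <= c -> M c <= M b.
Proof.
move=> [_ _ step _]; move: c.
apply: int_up_ind => // c _ IH; have := step c; lia.
Qed.

Lemma maya_lipschitz (M : int -> int) (chi m b c : int) :
  maya M chi m -> b <= c -> M b <= M c + (c - b).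
Proof.
move=> [_ _ step _]; move: c.
apply: int_up_ind => [|c _ IH]; first by lia.
by have := step c; lia.
Qed.

(** This is the empty partition, from which every chain starts. *)
Lemma maya_ramp (chi : int) : maya (fun b : int => Num.max 0 (chi - b)) chi 0.
Proof.
split=> [b|b|b|a N]; try lia.
by rewrite big1 // => j _; rewrite subrr.
Qed.

(** On the columns congruent to [i] the value becomes the largest one compatible with both
    neighbours. It exceeds [M b] exactly when [M (b - 1) = M b + 1] and [M (b + 1) = M b], that is,
    when a box is addable on that diagonal. *)
Definition add_boxes (k : nat) (i : int) (M : int -> int) : int -> int :=
  fun b => if (k%:Z %| b - i)%Z then Num.min (M (b + 1) + 1) (M (b - 1)) else M b.

(* Two addable boxes on congruent diagonals bound a rim hook of at least [k - 1] boxes. *)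
Lemma maya_add_boxes (k : nat) (i : int) (M : int -> int) (chi m : int) :
  (1 < k)%N -> m <= k%:Z - 2 ->
  maya M chi m -> maya (add_boxes k i M) chi (m + 1).
Proof.
move=> k_gt1 le_mk Mm; have [M_ge0 M_ge M_step M_size] := Mm.
have stepm (b : int) : M b <= M (b - 1) <= M b + 1.
  by have := M_step (b - 1); rewrite subrK.
have bumpE (b : int) : M b <= add_boxes k i M b <= M b + 1.
  by rewrite /add_boxes; have := M_step b; have := stepm b; case: ifP => _; lia.
split=> [b|b|b|a N].
- by have := bumpE b; have := M_ge0 b; lia.
- by have := bumpE b; have := M_ge b; lia.
- have := M_step b; have := M_step (b + 1); have := stepm b; rewrite /add_boxes.
  rewrite addrK; case: (boolP (k%:Z %| b - i)%Z) => kb; first by rewrite dvdz_succF //; lia.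
  by case: ifP => _; lia.
pose e (j : nat) : int := add_boxes k i M (a + j%:Z) - M (a + j%:Z).
have -> : \sum_(j < N) (add_boxes k i M (a + j%:Z) - Num.max 0 (chi - (a + j%:Z))) =
    \sum_(j < N) (M (a + j%:Z) - Num.max 0 (chi - (a + j%:Z))) + \sum_(j < N) e j.
  by rewrite -big_split; apply: eq_bigr => j _; rewrite /e /=; lia.
apply: lerD => //; apply: (sum_le1 N e) => [j|j j' lt_jj].
  by rewrite /e; have := bumpE (a + j%:Z); lia.
rewrite /e; set b : int := a + j%:Z; set b' : int := a + j'%:Z.
have lt_bb : b < b' by rewrite /b /b'; lia.
rewrite /add_boxes; case: ifP => [kb|_]; last by lia.
case: ifP => [kb'|_]; last by lia.
move=> eb eb'; have gap : k%:Z <= b' - b by have := dvdz_gap _ _ _ kb kb'; lia.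
(* Each of the [k - 1] columns [b + 1, ..., b + k - 1] carries an excess of at least one: addability
   at [b'] keeps [M] positive there, and addability at [b] keeps it above [chi - c]. This
   contradicts [m <= k - 2]. *)
have := M_size (b + 1) k.-1; apply/negP; rewrite -ltNge.
apply: (@lt_le_trans _ _ (\sum_(j < k.-1) (1 : int))); first by rewrite sumr_const card_ord; lia.
apply: ler_sum => n _; have lt_n := ltn_ord n.
set c : int := b + 1 + n%:Z.
have := maya_anti _ _ _ c (b' - 1) Mm; have := maya_lipschitz _ _ _ (b + 1) c Mm.
have := M_ge b; have := M_ge0 b'; have := stepm b'; have := M_step b; rewrite /c; lia.
Qed.

(** Double counting of boxes: row [i] contains the columns from [chi - i] to [s i], and column [c]
    consists of the rows from [max 0 (chi - c)] to [M c - 1]. *)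
Lemma maya_sum (M : int -> int) (chi m : int) (s : nat -> int) (N : nat) : maya M chi m ->
  (forall i, (i < N)%N -> i%:Z + 1 <= M (s i)) ->
  \sum_(i < N) (i%:Z + 1 - chi + s i) <= m.
Proof.
move=> Mm s_le; have [M_ge0 M_ge M_step M_size] := Mm.
(* The window of [L] columns starting at [a] contains all the intervals from [chi - i] to [s i] with
   [i < N]. *)
pose a := chi - N%:Z; pose L := (\sum_(i < N) `|s i - a|).+1%N.
apply: le_trans (M_size a L).
apply: (@le_trans _ _ (\sum_(i < N) \sum_(j < L) (chi - i%:Z <= a + j%:Z <= s i)%R%:Z)).
  apply: ler_sum => i _; have lt_i := ltn_ord i.
  apply: le_trans (sum_indicator_ge _ _ _ _ _); last by rewrite /a; lia.
  have : (`|s i - a| <= \sum_(i < N) `|s i - a|)%N by rewrite (bigD1 i) //= leq_addr.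
  by rewrite /L; lia.
rewrite exchange_big /=; apply: ler_sum => j _; set c : int := a + j%:Z.
apply: (@le_trans _ _ (\sum_(i < N) (Num.max 0 (chi - c) <= i%:Z < M c)%R%:Z)).
  apply: ler_sum => i _; have := s_le i (ltn_ord i).
  by have := maya_anti _ _ _ c (s i) Mm; lia.
apply: le_trans (sum_indicator_le _ _ _ _) _; first by lia.
by have := M_ge0 c; have := M_ge c; lia.
Qed.

Lemma maya_last (M : int -> int) (chi m : int) (i : nat) : maya M chi m ->
  exists c : int, i%:Z + 1 <= M c /\ M (c + 1) <= i%:Z.
Proof.
move=> Mm; have [M_ge0 M_ge M_step M_size] := Mm.
have [||c [Pc maxc]] := @int_greatest (fun c => i%:Z + 1 <= M c) (chi + `|m|%N%:Z)
  (chi - i%:Z - 1).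
- by have := M_ge (chi - i%:Z - 1); lia.
(* Beyond [chi] the ramp is zero, so a row reaching past [chi + |m|] would give [|m| + 1] columns of
   positive excess. *)
- move=> c Mc; case: leP => // gt_c; exfalso.
  have := M_size chi `|m|.+1%N; apply/negP; rewrite -ltNge.
  apply: (@lt_le_trans _ _ (\sum_(j < `|m|.+1) (1 : int))).
    by rewrite sumr_const card_ord; lia.
  apply: ler_sum => j _; have := ltn_ord j.
  by have := maya_anti _ _ _ (chi + j%:Z) c Mm; lia.
exists c; split=> //; case: leP => // lt_i.
by have := maxc (c + 1); lia.
Qed.

(** * Slipfaces, affine reflections and their action on Maya diagrams *)

(* [t a b] stands for [r(D + a u - b v) + 1] and [tau] for the transmission permutation. *)
Definition slipface (tau : int -> int) (t : int -> int -> int) (chi K : int) : Prop :=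
  [/\ forall a b : int, t a b = t a (b + 1) + (tau b <= a)%R%:Z,
      forall a b : int, a - b <= - K -> t a b = 0 &
      forall a b : int, K <= a - b -> t a b = a - b + chi].

(** A simple reflection of the affine symmetric group: it exchanges [b - 1] and [b] for every [b]
    congruent to [i]. *)
Definition kswap (k : nat) (i b : int) : int :=
  if (k%:Z %| b - i)%Z then b - 1 else if (k%:Z %| b + 1 - i)%Z then b + 1 else b.

Lemma kswapK (k : nat) (i : int) : (1 < k)%N -> involutive (kswap k i).
Proof.
move=> k_gt1 b; rewrite /kswap; case: (boolP (k%:Z %| b - i)%Z) => kb.
  by rewrite dvdz_predF // subrK kb.
case: (boolP (k%:Z %| b + 1 - i)%Z) => kb1; first by rewrite kb1 addrK.
by rewrite (negbTE kb) (negbTE kb1).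
Qed.

Lemma kswap_shift (k : nat) (i b z : int) : (k%:Z %| z)%Z -> kswap k i (b + z) = kswap k i b + z.
Proof.
move=> kz; rewrite /kswap.
have -> : b + z - i = b - i + z by ring.
have -> : b + z + 1 - i = b + 1 - i + z by ring.
rewrite !(rpredDr _ kz); case: ifP => _; first by ring.
by case: ifP => _; ring.
Qed.

Lemma periodic_dvd (tau : int -> int) (k : nat) (z b : int) :
  (forall c : int, tau (c + k%:Z) = tau c + k%:Z) -> (k%:Z %| z)%Z -> tau (b + z) = tau b + z.
Proof.
move=> per /dvdzP [q ->].
have pernat (n : nat) (c : int) : tau (c + n%:Z * k%:Z) = tau c + n%:Z * k%:Z.
  elim: n => [|n IH]; first by rewrite mul0r !addr0.
  have -> : c + n.+1%:Z * k%:Z = c + n%:Z * k%:Z + k%:Z by lia.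
  by rewrite per IH; lia.
case: (intP q) => [|n|n]; rewrite ?mul0r ?addr0 //.
have := pernat n.+1 (b - n.+1%:Z * k%:Z); rewrite subrK => ->.
by rewrite mulNr; ring.
Qed.

(** Applying the reflection to both entries sends inversions of [tau \o kswap k i] to inversions of
    [tau], keeps inequivalent ones inequivalent, and misses the class of [(i - 1, i)]. That class
    can thus be added to any family. *)
Lemma inv_le_kswap (tau : int -> int) (k : nat) (i g : int) : (1 < k)%N ->
  (forall c : int, tau (c + k%:Z) = tau c + k%:Z) -> tau i < tau (i - 1) ->
  inv_le tau k (g + 1) -> inv_le (tau \o kswap k i) k g.
Proof.
move=> k_gt1 per desc inv s s_inv s_pw.
pose f (p : int * int) := (kswap k i p.1, kswap k i p.2).
have kdesc (b : int) : (k%:Z %| b - i)%Z -> tau b < tau (b - 1).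
  move=> kb; have {1}-> : b = i + (b - i) by lia.
  have -> : b - 1 = i - 1 + (b - i) by lia.
  by rewrite !(periodic_dvd _ _ _ _ per kb); lia.
have keq (p q : int * int) : kequiv k (f p) (f q) -> kequiv k p q.
  rewrite /kequiv /= => /andP [/eqP eq1 k1].
  have := kswap_shift _ i (kswap k i q.1) _ k1; rewrite [in RHS]kswapK //.
  have k2 := k1; rewrite eq1 in k2.
  have := kswap_shift _ i (kswap k i q.2) _ k2; rewrite [in RHS]kswapK //.
  rewrite ![kswap k i q.1 + _]addrC ![kswap k i q.2 + _]addrC !subrK !kswapK // => -> ->.
  have -> : q.1 + (kswap k i p.1 - kswap k i q.1) - q.1 = kswap k i p.1 - kswap k i q.1 by ring.
  by rewrite k1 eq1 andbT; lia.
have f_inv (p : int * int) : inversion (tau \o kswap k i) p ->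
    inversion tau (f p) /\ ~~ kequiv k (i - 1, i) (f p).
  rewrite /inversion /= => /andP [lt_p gt_p].
  (* The pairs [(b - 1, b)] with [b] congruent to [i] are the only ones whose order the reflection
     reverses; they are not inversions after the swap. *)
  have ne_p : ~~ ((k%:Z %| p.2 - i)%Z && (p.1 == p.2 - 1)).
    apply/negP => /andP [k2 /eqP p1]; have := kdesc _ k2; move: gt_p.
    have -> : kswap k i p.2 = p.2 - 1 by rewrite /kswap k2.
    have -> : kswap k i p.1 = p.2 by rewrite /kswap p1 dvdz_predF // subrK k2.
    by lia.
  split.
    rewrite gt_p andbT; move: ne_p; rewrite /kswap; case: (boolP (k%:Z %| p.2 - i)%Z) => k2 /=.
      case: ifP => _; first by lia.
      by case: ifP => k1; [have := dvdz_gap _ _ _ k1 k2; lia | lia].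
    move=> _; case: (boolP (k%:Z %| p.1 - i)%Z) => _; first by case: ifP; lia.
    case: (boolP (k%:Z %| p.1 + 1 - i)%Z) => k1; last by case: ifP; lia.
    case: (eqVneq p.2 (p.1 + 1)) => [e2|]; last by case: ifP; lia.
    by move: k2; rewrite e2 k1.
  (* If the image were equivalent to [(i - 1, i)], swapping back would put the entries of [p] in
     decreasing order. *)
  apply/negP; rewrite /kequiv /= => /andP [/eqP e1 k1].
  have k2 : (k%:Z %| kswap k i p.2 - i)%Z.
    by rewrite -[kswap k i p.2 - i]opprB rpredN -e1.
  move: lt_p; rewrite -[p.1](kswapK k i k_gt1) -[p.2](kswapK k i k_gt1).
  have -> : kswap k i p.1 = kswap k i p.2 - 1 by lia.
  by rewrite {1}/kswap dvdz_predF // subrK k2 /kswap k2; lia.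
have := inv ((i - 1, i) :: map f s); rewrite /= size_map.
rewrite all_map all_map pairwise_map => H.
suff: (size s).+1%:Z <= g + 1 by lia.
apply: H.
  apply/andP; split; first by rewrite /inversion /= desc; lia.
  by apply/allP => p /(allP s_inv) /f_inv [].
apply/andP; split; first by apply/allP => p /(allP s_inv) /f_inv [].
apply: sub_pairwise s_pw => p q /=; apply: contra; exact: keq.
Qed.

(** Without descents an injective map is strictly increasing, and surjectivity leaves no gap between
    consecutive values. *)
Lemma increasing_bijection_shift (tau : int -> int) : bijective tau ->
  (forall i : int, tau (i - 1) <= tau i) -> forall b : int, tau b = b + tau 0.
Proof.
move=> [tau' tauK tauK'] incr.
have step (i : int) : tau i < tau (i + 1).
  have := incr (i + 1); rewrite addrK le_eqVlt => /orP [/eqP /(can_inj tauK)|//]; lia.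
have mono (b c : int) : b <= c -> tau b <= tau c.
  by move: c; apply: int_up_ind => // c _ IH; have := step c; lia.
have succ (b : int) : tau (b + 1) = tau b + 1.
  pose y := tau' (tau b + 1); have tau_y : tau y = tau b + 1 by rewrite tauK'.
  have := step b; have := mono y b; have := mono (b + 1) y; lia.
move=> b; case: (leP 0 b).
  move: b; apply: int_up_ind => [|b _ IH]; first by rewrite add0r.
  by rewrite succ IH; ring.
move/ltW; move: b; apply: int_down_ind => [|b _ IH]; first by rewrite add0r.
by have := succ (b - 1); rewrite subrK; lia.
Qed.

(** All steps of [t] are explicit here. Descending in [b] from the region where [t] vanishes gives
    zero on the line [a = b + c0 - 1]; continuing along [a = 0] into the linear region identifies
    [chi]. *)
Lemma slipface_shift (tau : int -> int) (t : int -> int -> int) (chi K c0 : int) :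
  slipface tau t chi K -> (forall b : int, tau b = b + c0) ->
  chi = 1 - c0 /\ forall b : int, t (b + c0 - 1) b = 0.
Proof.
move=> [t_step t_0 t_big] tauE.
have t0 (b : int) : t (b + c0 - 1) b = 0.
  pose a : int := b + c0 - 1; rewrite -/a.
  apply: (@int_down_ind (fun z : int => b <= z -> t a z = 0) (Num.max b (a + K))) => //;
    [by move=> _; apply: t_0; lia | | by lia].
  move=> y _ IH le_y; rewrite t_step subrK IH ?tauE; last by lia.
  by rewrite /a; lia.
split=> //; pose z : int := Num.min (1 - c0) (- K).
have : z <= 1 - c0 by rewrite /z; lia.
have : t 0 z = 0 - z + chi by apply: t_big; rewrite /z; lia.
move=> tz /(@int_down_ind (fun z : int => t 0 z = 1 - c0 - z) (1 - c0)) H.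
have : t 0 z = 1 - c0 - z.
  apply: H; first by rewrite subrr -[RHS](t0 (1 - c0)); congr t; ring.
  by move=> y le_y IH; rewrite t_step subrK IH tauE; lia.
by lia.
Qed.

(* Composing with the simple affine reflection [kswap k i] changes the slipface only on the
   columns [b = i] modulo [k]. *)
Lemma slipface_kswap (tau : int -> int) (t : int -> int -> int) (chi K : int) (k : nat) (i : int) :
  (1 < k)%N -> slipface tau t chi K ->
  slipface (tau \o kswap k i)
    (fun a b => if (k%:Z %| b - i)%Z then t a (b + 1) + (tau (b - 1)%R <= a)%R%:Z else t a b)
    chi (K + 1).
Proof.
move=> k_gt1 [t_step t_0 t_big]; split=> a b.
- rewrite /= /kswap; case: (boolP (k%:Z %| b - i)%Z) => kb; first by rewrite dvdz_succF.
  case: (boolP (k%:Z %| b + 1 - i)%Z) => kb1; last by rewrite t_step.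
  by rewrite addrK t_step (t_step a (b + 1)); lia.
- move=> le_ab; case: ifP => _; last by apply: t_0; lia.
  have := t_step a (b - 1); rewrite subrK !t_0; by lia.
- move=> le_ab; case: ifP => _; last by apply: t_big; lia.
  have := t_step a (b - 1); rewrite subrK !t_big; by lia.
Qed.

Lemma maya_shift (M : int -> int) (chi m c : int) :
  maya M chi m -> maya (fun b => M (b + c)) (chi - c) m.
Proof.
move=> [M_ge0 M_ge M_step M_size]; split=> [b|b|b|a N] //.
- by have := M_ge (b + c); lia.
- by have := M_step (b + c); rewrite addrAC.
apply: le_trans (M_size (a + c) N); apply: ler_sum => j _.
have -> : a + j%:Z + c = a + c + j%:Z by ring.
by lia.
Qed.

(* Every descent of [tau] that is peeled off adds at most one box. *)
Lemma maya_slipface (N k : nat) (tau : int -> int) (t : int -> int -> int)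
    (chi K : int) (A : int -> int) (chiA m : int) :
  (0 < k)%N -> bijective tau -> (forall c : int, tau (c + k%:Z) = tau c + k%:Z) ->
  slipface tau t chi K -> inv_le tau k N%:Z -> maya A chiA m -> m + N%:Z < k%:Z ->
  exists M : int -> int, maya M (chiA + chi - 1) (m + N%:Z) /\
    forall b : int, exists c : int, A c + t (c - 1) b <= M b.
Proof.
move=> k_gt0 + + + + Am.
have base tau1 t1 K1 : bijective tau1 -> slipface tau1 t1 chi K1 ->
    ~ (exists i : int, tau1 i < tau1 (i - 1)) ->
    exists M : int -> int, maya M (chiA + chi - 1) m /\
      forall b : int, exists c : int, A c + t1 (c - 1) b <= M b.
  move=> bij slip no_desc; pose c0 := tau1 0.
  have tauE : forall b : int, tau1 b = b + c0.
    apply: increasing_bijection_shift bij _ => i; rewrite leNgt.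
    by apply/negP => lt_i; apply: no_desc; exists i.
  have [-> t0] := slipface_shift _ _ _ _ _ slip tauE.
  (* A translation only translates the partition: at [c = b + c0] the term [t (c - 1) b] is zero. *)
  exists (fun b => A (b + c0)); split=> [|b]; last by exists (b + c0); rewrite t0 addr0.
  have -> : chiA + (1 - c0) - 1 = chiA - c0 by ring.
  exact: maya_shift.
elim: N tau t K => [|N IH] tau t K tau_bij per slip inv lt_mk;
  case: (classic (exists i : int, tau i < tau (i - 1))) => [[i desc]|no_desc].
- suff: (size [:: (i - 1, i)])%:Z <= 0%:Z by [].
  by apply: inv; rewrite //= /inversion /= desc; lia.
- have -> : m + 0%:Z = m by rewrite addr0.
  exact: (base tau t K tau_bij slip no_desc).
2: {
  have [M [Mm M_ge]] := base _ _ _ tau_bij slip no_desc.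
  by exists M; split=> //; apply: maya_le Mm; lia. }
(* For [k = 1] periodicity gives [tau i = tau (i - 1) + 1], which excludes a descent. *)
have k_gt1 : (1 < k)%N.
  case: (ltnP 1 k) => // le_k; have k1 : k = 1%N by lia.
  by have := per (i - 1); rewrite k1 subrK; lia.
have swap_bij : bijective (tau \o kswap k i).
  by apply: bij_comp => //; exists (kswap k i); apply: kswapK.
have swap_per (c : int) : (tau \o kswap k i) (c + k%:Z) = (tau \o kswap k i) c + k%:Z.
  by rewrite /= kswap_shift ?per.
have swap_inv : inv_le (tau \o kswap k i) k N%:Z.
  by apply: inv_le_kswap => //; rewrite -PoszD addn1.
have [|M [Mm M_ge]] := IH _ _ _ swap_bij swap_per (slipface_kswap _ _ _ _ _ i k_gt1 slip) swap_inv.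
  by lia.
exists (add_boxes k i M); split.
  have -> : m + N.+1%:Z = m + N%:Z + 1 by lia.
  by apply: maya_add_boxes => //; lia.
have [t_step _ _] := slip.
move=> b; rewrite /add_boxes; case: ifP => [kb|kb]; last first.
  by have [c] := M_ge b; rewrite kb; exists c.
(* The columns next to [b] are untouched by the swap. As [t] is nonincreasing in [b] with steps of
   at most one, the bound at either neighbour transfers to column [b], which gives the two terms of
   the minimum. *)
case: (leP (M (b + 1) + 1) (M (b - 1))) => _.
  have [c] := M_ge (b + 1); rewrite dvdz_succF // => le_c; exists c.
  by rewrite t_step; lia.
have [c] := M_ge (b - 1); rewrite dvdz_predF // => le_c; exists c.
by have := t_step (c - 1) (b - 1); rewrite subrK; lia.
Qed.

(** Inversion exchanges positions with values, and conjugation by negation is a half-turn; both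
    preserve inversions. Periodicity of [tau] carries equivalent pairs to equivalent pairs. *)
Lemma inv_le_transpose (tau tau' : int -> int) (k : nat) (g : int) :
  cancel tau' tau -> (forall c : int, tau (c + k%:Z) = tau c + k%:Z) ->
  inv_le tau k g -> inv_le (fun b => - tau' (- b)) k g.
Proof.
move=> tauK per inv s s_inv s_pw.
pose f (p : int * int) := (tau' (- p.1), tau' (- p.2)).
rewrite -(size_map f); apply: inv.
  rewrite all_map; apply/allP => p /(allP s_inv).
  by rewrite /inversion /= !tauK => /andP [? ?]; lia.
rewrite pairwise_map; apply: sub_pairwise s_pw => p q /=; apply: contra.
rewrite /kequiv /= => /andP [/eqP e1 k1].
have k2 := k1; rewrite e1 in k2.
have := periodic_dvd _ _ _ (tau' (- q.1)) per k1.
have := periodic_dvd _ _ _ (tau' (- q.2)) per k2.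
rewrite ![tau' (- q.1) + _]addrC ![tau' (- q.2) + _]addrC !subrK !tauK => E2 E1.
have -> : p.1 - q.1 = - (tau' (- p.1) - tau' (- q.1)) by lia.
by rewrite rpredN k1 andbT; lia.
Qed.

(** * Rank functions of twice-marked graphs *)

(** The clauses abstract, for [r + 1] on the twists of one divisor: the effect of one chip at [v]
    and at [u], submodularity, the relation [k u ~ k v], and the behaviour in negative and in large
    degree. *)
Definition rank_function (k : nat) (t : int -> int -> int) : Prop :=
  [/\ forall a b : int, t a (b + 1) <= t a b <= t a (b + 1) + 1,
      forall a b : int, t (a - 1) b <= t a b <= t (a - 1) b + 1,
      forall a b : int, t (a - 1) b - t (a - 1) (b + 1) <= t a b - t a (b + 1),
      forall a b : int, t (a + k%:Z) (b + k%:Z) = t a b &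
      exists C : int, forall a b : int, (a - b < - C -> t a b = 0) /\ a - b - C <= t a b].

(** This exchanges the two marked points: the value is [r(D - b u + a v) + 1]. It lets the right
    half of a chain reuse the results for the left half. *)
Definition transpose (t : int -> int -> int) (a b : int) : int := t (- b) (- a).

Lemma rank_function_transpose (k : nat) (t : int -> int -> int) :
  rank_function k t -> rank_function k (transpose t).
Proof.
move=> [t_b t_a t_sup t_per [C t_C]]; rewrite /transpose.
split=> [a b|a b|a b|a b|].
- by rewrite opprD; apply: t_a.
- by have := t_b (- b) (- a); rewrite opprB [1 - a]addrC.
- have := t_sup (- b) (- a).
  have -> : - (a - 1) = - a + 1 by ring.
  have -> : - (b + 1) = - b - 1 by ring.
  move: (t (- b - 1) _) (t (- b - 1) _) (t (- b) _) (t (- b) _) => ? ? ? ?; lia.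
- by rewrite -(t_per _ (- (a + k%:Z))); congr t; ring.
exists C => a b; have [t0 t_ge] := t_C (- b) (- a).
by split=> [?|]; [apply: t0; lia | lia].
Qed.

(* If column [b] never jumped, periodicity would repeat this on all columns congruent to [b],
   and [t] would grow too slowly. *)
Lemma rank_function_column_jump (k : nat) (t : int -> int -> int) (b : int) : (0 < k)%N ->
  rank_function k t -> exists a : int, t a b = t a (b + 1) + 1.
Proof.
move=> k_gt0 [t_b t_a _ t_per [C t_C]]; apply: NNPP => no_jump.
have flat (a : int) : t a b = t a (b + 1).
  have := t_b a b; case: (eqVneq (t a b) (t a (b + 1) + 1)) => [e|]; last by lia.
  by case: no_jump; exists a.
have lip (a c d : int) : c <= d -> t a c <= t a d + (d - c).
  move: d; apply: int_up_ind => [|d _ IH]; first by lia.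
  by have := t_b a d; lia.
have per_nat (n : nat) (a c : int) : t (a + n%:Z * k%:Z) (c + n%:Z * k%:Z) = t a c.
  elim: n => [|n IH]; first by rewrite mul0r !addr0.
  by rewrite -IH -[RHS]t_per; congr t; lia.
have slow (n : nat) : t 0 (b - n%:Z * k%:Z) <= t 0 b + n%:Z * (k%:Z - 1).
  elim: n => [|n IH]; first by rewrite !mul0r subr0 addr0.
  have := lip 0 (b - n.+1%:Z * k%:Z + 1) (b - n%:Z * k%:Z).
  have <- : t 0 (b - n.+1%:Z * k%:Z) = t 0 (b - n.+1%:Z * k%:Z + 1).
    by rewrite -(per_nat n.+1) subrK flat -(per_nat n.+1 0); congr t; ring.
  by lia.
have [n lt_n] : exists n : nat, t 0 b + b + C < n%:Z.
  by exists (`|(t 0 b + b + C)%R|.+1)%N; lia.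
have := slow n; have [_] := t_C 0 (b - n%:Z * k%:Z); lia.
Qed.

(** By submodularity a jump of column [b] at [a] persists for all larger [a]. Jumps are absent for
    very negative [a] and occur somewhere, so [tau b] is the least [a] with a jump. *)
Lemma rank_function_column (k : nat) (t : int -> int -> int) : (0 < k)%N ->
  rank_function k t ->
  exists tau : int -> int, forall a b : int, t a b = t a (b + 1) + (tau b <= a)%R%:Z.
Proof.
move=> k_gt0 rf; have [t_b t_a t_sup t_per [C t_C]] := rf.
have col (b : int) : exists z : int, forall a : int, t a b = t a (b + 1) + (z <= a)%R%:Z.
  have [a0 jump0] := rank_function_column_jump _ _ b k_gt0 rf.
  have [||z [Pz minz]] := @int_least (fun a : int => t a b = t a (b + 1) + 1) (b - C) a0 => //.
    move=> a ja; case: leP => // lt_a.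
    have [ta0 _] := t_C a b; have [ta1 _] := t_C a (b + 1).
    by move: ja; rewrite ta0 ?ta1; lia.
  exists z => a; case: (leP z a) => [|lt_az].
    move: a; apply: int_up_ind => // a _ IH.
    by have := t_b (a + 1) b; have := t_sup (a + 1) b; rewrite addrK; lia.
  have := minz a; have := t_b a b; case: (eqVneq (t a b) (t a (b + 1) + 1)) => [e|]; last by lia.
  by move=> _ /(_ e); lia.
exists (fun b => proj1_sig (constructive_indefinite_description _ (col b))) => a b.
by case: constructive_indefinite_description.
Qed.

(** The displacement [tau b - b] depends only on [b] modulo [k]; summing absolute values over the
    residues bounds all of them. *)
Lemma periodic_bounded (tau : int -> int) (k : nat) : (0 < k)%N ->
  (forall c : int, tau (c + k%:Z) = tau c + k%:Z) ->
  exists K : int, forall b : int, tau b <= b + K.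
Proof.
move=> k_gt0 per; exists (\sum_(j < k) `|tau j%:Z - j%:Z|%N)%N%:Z => b.
rewrite {1 2}(divz_eq b k%:Z) addrC (periodic_dvd _ _ _ _ per) ?dvdz_mull //.
have r_ge0 : 0 <= (b %% k)%Z by apply: modz_ge0; lia.
have r_lt : (b %% k)%Z < k%:Z by apply: ltz_pmod; lia.
have rk : (`|(b %% k)%Z| < k)%N by lia.
rewrite (bigD1 (Ordinal rk)) //= gez0_abs //.
by set S := (\sum_(_ < k | _) _)%N; lia.
Qed.

Lemma rank_function_transmission (k : nat) (t : int -> int -> int) : (0 < k)%N ->
  rank_function k t ->
  exists (tau tau' : int -> int) (chi K : int),
    [/\ cancel tau tau' /\ cancel tau' tau,
        forall c : int, tau (c + k%:Z) = tau c + k%:Z,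
        slipface tau t chi K,
        slipface (fun b => - tau' (- b)) (transpose t) chi K &
        forall a b : int, (if tau b == a then 1 else 0) =
          t a b - t (a - 1) b - t a (b + 1) + t (a - 1) (b + 1)].
Proof.
move=> k_gt0 rf; have [t_b t_a t_sup t_per [C t_C]] := rf.
have [tau tauE] := rank_function_column _ _ k_gt0 rf.
have [tau1 tau1E] := rank_function_column _ _ k_gt0 (rank_function_transpose _ _ rf).
pose tau' (a : int) : int := - tau1 (- a).
have tau'E (a b : int) : t a b = t (a - 1) b + (b <= tau' a)%R%:Z.
  have := tau1E (- b) (- a); rewrite /transpose /tau' !opprK.
  have -> : - (- a + 1) = a - 1 by ring.
  by lia.
(* Both sides say that the mixed second difference of [t] at [(a, b)] equals one. *)
have tau_iff (a b : int) : (tau b == a) = (tau' a == b).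
  have := tauE a b; have := tauE (a - 1) b; have := tau'E a b; have := tau'E a (b + 1); lia.
have tauK : cancel tau tau' by move=> b; apply/eqP; rewrite -tau_iff.
have tauK' : cancel tau' tau by move=> a; apply/eqP; rewrite tau_iff.
have per (c : int) : tau (c + k%:Z) = tau c + k%:Z.
  have cmp (a : int) : (tau (c + k%:Z)%R <= a + k%:Z) = (tau c <= a).
    have := tauE (a + k%:Z) (c + k%:Z); have := tauE a c.
    rewrite [c + _ + 1]addrAC !t_per.
    by move=> -> /addrI; case: (tau c <= a); case: (tau _ <= _).
  by have := cmp (tau c); have := cmp (tau (c + k%:Z) - k%:Z); lia.
have [K tau_le] := periodic_bounded _ _ k_gt0 per.
(* For [b <= a - K] column [b] always jumps, since [tau b <= b + K <= a]; so [t a b - (a - b)] is a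
   constant [x a] there. Its independence of [a] yields [chi]. *)
pose x (a : int) : int := t a (a - K + 1) - K + 1.
have xE (a b : int) : b <= a - K + 1 -> t a b = a - b + x a.
  move: b; apply: int_down_ind => [|b le_b IH]; first by rewrite /x; ring.
  by rewrite tauE subrK IH; have := tau_le (b - 1); lia.
(* At such a [b] both linear formulas apply and row [a] jumps, so [t] and [a - b] grow together. *)
have x_pred (a : int) : x (a - 1) = x a.
  pose b : int := Num.min (a - K) (tau' a).
  have := xE a b; have := xE (a - 1) b; have := tau'E a b; rewrite /b; lia.
have x0 (a : int) : x a = x 0.
  case: (leP 0 a) => [|/ltW].
    by move: a; apply: int_up_ind => // a _ IH; rewrite -x_pred addrK.
  by move: a; apply: int_down_ind => // a _ IH; rewrite x_pred.
(* The [C + 1] turns the strict bound of [rank_function] into the nonstrict one of [slipface]. *)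
exists tau, tau', (x 0), (Num.max K (C + 1)); split=> //.
- split=> // a b le_ab; first by have [t0 _] := t_C a b; apply: t0; lia.
  by rewrite xE ?x0; lia.
- split=> a b; rewrite /tau' /transpose ?opprK.
  + exact: tau1E.
  + by move=> le_ab; have [t0 _] := t_C (- b) (- a); apply: t0; lia.
  by move=> le_ab; rewrite xE ?x0; lia.
move=> a b; have := tauE a b; have := tauE (a - 1) b.
by case: eqP; lia.
Qed.

(** * Divisors and ranks *)

Lemma Posz_sum (I : finType) (P : pred I) (F : I -> nat) :
  (\sum_(i | P i) F i)%N%:Z = \sum_(i | P i) (F i)%:Z.
Proof. exact: (big_morph Posz PoszD). Qed.

Lemma firingE (G : graph) (c : gV G -> int) (x : gV G) : is_graph G ->
  \sum_w c w * fire w x = \sum_w (c w - c x) * (gm w x)%:Z.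
Proof.
move=> [sym loopless _ _].
rewrite (bigD1 x) //= [RHS](bigD1 x) //= subrr mul0r add0r.
rewrite /fire eqxx /valence Posz_sum (bigD1 x) //= loopless add0r mulrN mulr_sumr addrC.
rewrite -sumrB; apply: eq_bigr => w /negbTE ne_wx.
by rewrite eq_sym ne_wx mulrBl sym.
Qed.

Lemma ddeg_firing (G : graph) (c : gV G -> int) : is_graph G ->
  \sum_(x : gV G) \sum_w c w * fire w x = 0.
Proof.
move=> Gg; have [sym _ _ _] := Gg.
rewrite (eq_bigr _ (fun x _ => firingE _ c x Gg)); set S := \sum_x _.
suff : S = - S by lia.
rewrite {1}/S exchange_big /S -sumrN; apply: eq_bigr => x _.
rewrite -sumrN; apply: eq_bigr => w _.
by rewrite sym -mulNr opprB.
Qed.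

Lemma lin_equiv_ext (G : graph) (D D' : divisor G) : D =1 D' -> lin_equiv D D'.
Proof. by move=> eqD; exists (fun=> 0) => x; rewrite eqD subrr big1 // => w _; rewrite mul0r. Qed.

Lemma lin_equiv_sym (G : graph) (D D' : divisor G) : lin_equiv D D' -> lin_equiv D' D.
Proof.
move=> [c eqc]; exists (fun w => - c w) => x.
rewrite -opprB eqc -sumrN; by apply: eq_bigr => w _; rewrite mulNr.
Qed.

Lemma lin_equiv_trans (G : graph) (D1 D2 D3 : divisor G) :
  lin_equiv D1 D2 -> lin_equiv D2 D3 -> lin_equiv D1 D3.
Proof.
move=> [c eqc] [c' eqc']; exists (fun w => c w + c' w) => x.
under eq_bigr do rewrite mulrDl.
by rewrite big_split /= -eqc -eqc'; ring.
Qed.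

Lemma lin_equiv_addr (G : graph) (D D' F : divisor G) :
  lin_equiv D D' -> lin_equiv (fun x => D x + F x) (fun x => D' x + F x).
Proof. by move=> [c eqc]; exists c => x; rewrite -eqc; ring. Qed.

Lemma ddegD (G : graph) (D E : divisor G) : ddeg (fun x => D x + E x) = ddeg D + ddeg E.
Proof. exact: big_split. Qed.

Lemma ddegB (G : graph) (D E : divisor G) : ddeg (fun x => D x - E x) = ddeg D - ddeg E.
Proof. exact: sumrB. Qed.

Lemma ddeg_chip (G : graph) (u : gV G) : ddeg (chip u) = 1.
Proof.
rewrite /ddeg /chip (bigD1 u) //= eqxx big1 ?addr0 // => x /negbTE -> //.
Qed.

Lemma ddegZ (G : graph) (a : int) (D : divisor G) : ddeg (fun x => a * D x) = a * ddeg D.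
Proof. by rewrite /ddeg mulr_sumr. Qed.

Lemma ddeg_twist (G : graph) (D : divisor G) (a : int) (u : gV G) (b : int) (v : gV G) :
  ddeg (twist D a u b v) = ddeg D + a + b.
Proof. by rewrite /twist !ddegD !ddegZ !ddeg_chip !mulr1. Qed.

Lemma effective_ddeg_ge0 (G : graph) (E : divisor G) : effective E -> 0 <= ddeg E.
Proof. by move=> effE; apply: sumr_ge0. Qed.

Lemma effectiveD (G : graph) (E F : divisor G) :
  effective E -> effective F -> effective (fun x => E x + F x).
Proof. by move=> effE effF x; apply: addr_ge0. Qed.

Lemma effective_chipZ (G : graph) (u : gV G) (a : int) :
  0 <= a -> effective (fun x => a * chip u x).
Proof. by move=> a_ge0 x; apply: mulr_ge0 => //; rewrite /chip; case: ifP. Qed.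

Lemma linsys_equiv (G : graph) (D D' : divisor G) :
  lin_equiv D D' -> linsys_nonempty D -> linsys_nonempty D'.
Proof. by move=> eqD [E [effE eqE]]; exists E; split=> //; apply: lin_equiv_trans eqE eqD. Qed.

Lemma linsys_ext (G : graph) (D D' : divisor G) :
  D =1 D' -> linsys_nonempty D -> linsys_nonempty D'.
Proof. by move/lin_equiv_ext; apply: linsys_equiv. Qed.

Lemma linsys_add (G : graph) (D E : divisor G) :
  effective E -> linsys_nonempty D -> linsys_nonempty (fun x => D x + E x).
Proof.
move=> effE [F [effF eqF]]; exists (fun x => F x + E x); split; first exact: effectiveD.
exact: lin_equiv_addr.
Qed.

Lemma ddeg_equiv (G : graph) (D D' : divisor G) : is_graph G ->
  lin_equiv D D' -> ddeg D = ddeg D'.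
Proof.
move=> Gg [c eqc]; apply/eqP; rewrite -subr_eq0 -ddegB /ddeg.
by rewrite (eq_bigr _ (fun x _ => eqc x)) ddeg_firing.
Qed.

Lemma linsys_ddeg_ge0 (G : graph) (D : divisor G) : is_graph G ->
  linsys_nonempty D -> 0 <= ddeg D.
Proof. by move=> Gg [E [effE /(ddeg_equiv _ _ _ Gg) <-]]; apply: effective_ddeg_ge0. Qed.

Lemma graph_vertex (G : graph) : is_graph G -> exists v : gV G, True.
Proof. by case=> _ _ /card_gt0P [v _] _; exists v. Qed.

Lemma rank_ge_mono (G : graph) (D : divisor G) (r r' : int) : is_graph G ->
  r' <= r -> rank_ge D r -> rank_ge D r'.
Proof.
move=> Gg le_r Dr E effE degE; have [v _] := graph_vertex _ Gg.
have effF : effective (fun x => (r - r') * chip v x) by apply: effective_chipZ; lia.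
have := Dr _ (effectiveD _ _ _ effE effF); rewrite ddegD degE ddegZ ddeg_chip => DE.
have {}DE := linsys_add _ _ _ effF (DE ltac:(ring)).
by apply: linsys_ext DE => x /=; ring.
Qed.

Lemma rank_ge0 (G : graph) (D : divisor G) : rank_ge D 0 <-> linsys_nonempty D.
Proof.
split=> [D0|D0 E effE degE].
  have := D0 (fun=> 0); rewrite /ddeg big1 // => H.
  by apply: linsys_ext (H _ erefl) => // x; rewrite subr0.
have E0 x : E x = 0.
  apply/eqP; rewrite eq_le effE andbT -degE /ddeg (bigD1 x) //= lerDl.
  by apply: sumr_ge0.
by apply: linsys_ext D0 => x; rewrite E0 subr0.
Qed.

(** The choice in [grank] is meaningful once a maximal [r] exists: removing [r] chips must leave
    nonnegative degree, so [r] is at most [ddeg D]. *)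
Lemma is_rank_grank (G : graph) (D : divisor G) : is_graph G -> is_rank D (grank D).
Proof.
move=> Gg; apply: epsilon_spec; case: (classic (linsys_nonempty D)) => D0; last first.
  by exists (-1); left.
have [||r [[r_ge0 Dr] maxr]] := @int_greatest (fun r : int => 0 <= r /\ rank_ge D r) (ddeg D) 0.
- by split=> //; apply/rank_ge0.
- move=> r [r_ge0 Dr]; have [v _] := graph_vertex _ Gg.
  have := Dr _ (effective_chipZ _ v _ r_ge0); rewrite ddegZ ddeg_chip mulr1.
  by move=> /(_ erefl) /(linsys_ddeg_ge0 _ _ Gg); rewrite ddegB ddegZ ddeg_chip; lia.
by exists r; right; split=> //; split=> //; split=> // r' *; apply: maxr.
Qed.

Lemma grank_geN1 (G : graph) (D : divisor G) : is_graph G -> -1 <= grank D.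
Proof. by move/is_rank_grank => /(_ D) [[_ ->]|[_ [r_ge0 _]]] //; lia. Qed.

Lemma grank_geP (G : graph) (D : divisor G) (m : int) : is_graph G -> 0 <= m ->
  m <= grank D <-> rank_ge D m.
Proof.
move=> Gg m_ge0; have [[D0 ->]|[D0 [r_ge0 [Dr maxr]]]] := is_rank_grank _ D Gg.
  split=> [|Dm]; first by lia.
  by case: D0; apply/rank_ge0; apply: rank_ge_mono Dm.
by split=> [le_m|]; [apply: rank_ge_mono Dr | apply: maxr].
Qed.

(** With [grank_lt] this gives a dual description of the rank: upper bounds are proved by exhibiting
    one effective divisor whose removal is fatal. *)
Lemma grank_obstruction (G : graph) (D : divisor G) : is_graph G ->
  exists E : divisor G, [/\ effective E, ddeg E = grank D + 1 &
    ~ linsys_nonempty (fun x => D x - E x)].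
Proof.
move=> Gg; apply: NNPP => noE.
suff: grank D + 1 <= grank D by lia.
apply/grank_geP => //; first by have := grank_geN1 _ D Gg; lia.
by move=> E effE degE; apply: NNPP => noDE; apply: noE; exists E.
Qed.

Lemma grank_lt (G : graph) (D E : divisor G) : is_graph G -> effective E ->
  ~ linsys_nonempty (fun x => D x - E x) -> grank D < ddeg E.
Proof.
move=> Gg effE noDE; rewrite ltNge; apply/negP => /grank_geP.
by move=> /(_ Gg (effective_ddeg_ge0 _ _ effE)) /(_ E effE erefl).
Qed.

Lemma grank_equiv (G : graph) (D D' : divisor G) : is_graph G ->
  lin_equiv D D' -> grank D = grank D'.
Proof.
move=> Gg; suff le (F F' : divisor G) : lin_equiv F F' -> grank F' <= grank F.
  by move=> eqD; apply/eqP; rewrite eq_le !le //; apply: lin_equiv_sym.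
move=> eqF; have [E [effE degE noE]] := grank_obstruction _ F Gg.
suff: grank F' < ddeg E by rewrite degE; lia.
apply: grank_lt => // FE; apply: noE; apply: linsys_equiv FE.
exact/lin_equiv_addr/lin_equiv_sym.
Qed.

Lemma grank_ext (G : graph) (D D' : divisor G) : is_graph G -> D =1 D' -> grank D = grank D'.
Proof. by move=> Gg /lin_equiv_ext; apply: grank_equiv. Qed.

Lemma grank_add (G : graph) (D F : divisor G) : is_graph G -> effective F ->
  grank D <= grank (fun x => D x + F x) <= grank D + ddeg F.
Proof.
move=> Gg effF; apply/andP; split.
  have [E [effE degE noE]] := grank_obstruction _ (fun x => D x + F x) Gg.
  suff: grank D < ddeg E by rewrite degE; lia.
  apply: grank_lt => // DE; apply: noE; have := linsys_add _ _ _ effF DE.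
  by apply: linsys_ext => x /=; ring.
have [E [effE degE noE]] := grank_obstruction _ D Gg.
suff: grank (fun x => D x + F x) < ddeg (fun x => E x + F x) by rewrite ddegD degE; lia.
apply: grank_lt => //; first exact: effectiveD.
by move=> DE; apply: noE; apply: linsys_ext DE => x /=; ring.
Qed.

Lemma grank_neg (G : graph) (D : divisor G) : is_graph G -> ddeg D < 0 -> grank D = -1.
Proof.
move=> Gg negD; have [[_ ->]//|[D0 _]] := is_rank_grank _ D Gg.
by have := linsys_ddeg_ge0 _ _ Gg D0; lia.
Qed.

(** * The Laplacian, and ranks in large degree *)

(** Maximum principle: where [c] is maximal, all neighbours must attain the maximum too, and
    connectivity spreads it. *)
Lemma firing0_const (G : graph) (c : gV G -> int) : is_graph G ->
  (forall x, \sum_w c w * fire w x = 0) -> forall x y, c x = c y.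
Proof.
move=> Gg c0; have [sym _ V0 conn] := Gg; have [v _] := graph_vertex _ Gg.
pose x := [arg max_(i > v) c i]%O.
have max_x w : c w <= c x by rewrite /x; case: arg_maxP => // i _ /(_ w isT).
suff all_x y : c y = c x by move=> y z; rewrite !all_x.
have /connectP [p path_p ->] := conn x y.
have : c x = c x by []; move: {1 3 4}x path_p.
elim: p => [|z p IH] w //= /andP [wz path_p] cw; apply: IH => //.
have := c0 w; rewrite firingE // => sum0.
apply/eqP; rewrite eq_le max_x /= leNgt; apply/negP => lt_z.
suff: \sum_w0 (c w0 - c w) * (gm w0 w)%:Z < 0 by rewrite sum0.
rewrite (bigD1 z) //= -[X in _ < X](addr0 0); apply: ltr_leD.
  by rewrite sym; nia.
by apply: sumr_le0 => i _; have := max_x i; nia.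
Qed.

(* The Laplacian corrected at the entry [(q, q)] is nonsingular; its adjugate shows that the
   difference of any two vertices is torsion. *)
Definition grounded_laplacian (G : graph) (q : gV G) : 'M[int]_#|gV G| :=
  \matrix_(i, j) (fire (enum_val i) (enum_val j)
                  + chip q (enum_val i) * chip q (enum_val j)).

Lemma mul_grounded_laplacian (G : graph) (q : gV G) (r : 'rV[int]_#|gV G|) (y : gV G) :
  (r *m grounded_laplacian G q) 0 (enum_rank y) =
  \sum_w r 0 (enum_rank w) * fire w y + r 0 (enum_rank q) * chip q y.
Proof.
rewrite mxE (reindex enum_rank) /=; last by apply: onW_bij; apply: enum_rank_bij.
under eq_bigr do rewrite mxE !enum_rankK mulrDr.
rewrite big_split /=; congr (_ + _).
rewrite (bigD1 q) //= big1 ?addr0; first by rewrite /chip eqxx mul1r.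
by move=> w /negbTE ne_wq; rewrite /chip ne_wq mul0r mulr0.
Qed.

Lemma sum_grounded (G : graph) (q : gV G) (c : gV G -> int) (a : int) : is_graph G ->
  \sum_y (\sum_w c w * fire w y + a * chip q y) = a.
Proof.
by move=> Gg; rewrite big_split /= ddeg_firing // add0r -mulr_sumr [X in a * X]ddeg_chip mulr1.
Qed.

(** Summing the equations of a kernel vector over all vertices shows that its entry at [q] is zero.
    It is then harmonic, hence constant, hence zero. *)
Lemma det_grounded_laplacian (G : graph) (q : gV G) : is_graph G ->
  \det (grounded_laplacian G q) != 0.
Proof.
move=> Gg; apply/negP => /det0P [r nz_r r0].
pose c w := r 0 (enum_rank w).
have eq0 y : \sum_w c w * fire w y + c q * chip q y = 0.
  by rewrite -mul_grounded_laplacian r0 mxE.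
have cq0 : c q = 0 by rewrite -(sum_grounded G q c (c q) Gg) big1.
have const := firing0_const G c Gg.
case/negP: nz_r; apply/eqP/rowP => j; rewrite mxE -[j]enum_valK -/(c _) -cq0.
by apply: const => x; have := eq0 x; rewrite cq0 mul0r addr0.
Qed.

Lemma chip_torsion (G : graph) (q : gV G) : is_graph G ->
  exists (d : int) (c : gV G -> gV G -> int), 0 < d /\
    forall x y, d * chip x y - d * chip q y = \sum_w c x w * fire w y.
Proof.
move=> Gg; pose A := grounded_laplacian G q; pose d : int := \det A.
have d_nz : d != 0 := det_grounded_laplacian G q Gg.
pose c x w : int := \adj A (enum_rank x) (enum_rank w).
have cE x y : \sum_w c x w * fire w y + c x q * chip q y = d * chip x y.
  have := mul_grounded_laplacian G q (row (enum_rank x) (\adj A)) y.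
  rewrite -row_mul -/A mul_adj_mx [row _ _ _ _]mxE [_%:M _ _]mxE (inj_eq enum_rank_inj) -/d.
  rewrite [row _ _ _ _]mxE -/(c x q).
  have -> : \sum_w row (enum_rank x) (\adj A) 0 (enum_rank w) * fire w y =
      \sum_w c x w * fire w y by apply: eq_bigr => w _; rewrite [row _ _ _ _]mxE.
  by move=> <-; rewrite /chip [y == x]eq_sym; case: eqP => _; rewrite ?mulr1 ?mulr0.
have cq x : c x q = d.
  rewrite -(sum_grounded G q (c x) (c x q) Gg) (eq_bigr _ (fun y _ => cE x y)).
  by rewrite -mulr_sumr [X in d * X]ddeg_chip mulr1.
(* The sign makes the multiple positive without computing the sign of the determinant. *)
exists `|d|, (fun x w => Num.sg d * c x w); split=> [|x y]; first by rewrite normr_gt0.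
under eq_bigr do rewrite -mulrA.
rewrite -mulr_sumr normrEsg -!mulrA -mulrBr; congr (_ * _).
by rewrite -cE cq; ring.
Qed.

(** Since [d x ~ d q], every coefficient away from [q] can be reduced modulo [d], the surplus going
    to [q]. In large degree the coefficient at [q] is then nonnegative. *)
Lemma linsys_large_degree (G : graph) : is_graph G ->
  exists C : int, forall D : divisor G, C <= ddeg D -> linsys_nonempty D.
Proof.
move=> Gg; have [q _] := graph_vertex _ Gg.
have [d [c [d_gt0 cE]]] := chip_torsion G q Gg.
exists (\sum_(x : gV G) d) => D le_D.
pose m x := (D x %/ d)%Z.
pose E y : int := D y - \sum_x m x * (d * chip x y - d * chip q y).
have eqE : lin_equiv E D.
  exists (fun w => - \sum_x m x * c x w) => y.
  under eq_bigr do rewrite mulNr mulr_suml.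
  rewrite sumrN exchange_big /= /E addrC addKr; congr (- _).
  apply: eq_bigr => x _; rewrite cE mulr_sumr.
  by apply: eq_bigr => w _; rewrite mulrA.
have EneE y : y != q -> E y = (D y %% d)%Z.
  move=> /negbTE ne_yq; rewrite /E (bigD1 y) //= big1 => [|x ne_xy].
    by rewrite /chip eqxx ne_yq /m {1}(divz_eq (D y) d); ring.
  by rewrite /chip ne_yq [y == x]eq_sym (negbTE ne_xy); ring.
exists E; split=> // y; case: (eqVneq y q) => [->|ne_yq]; last first.
  by rewrite EneE //; apply: modz_ge0; lia.
move: le_D; rewrite -(ddeg_equiv _ _ _ Gg eqE) /ddeg (bigD1 q) //= [X in _ <= X](bigD1 q) //=.
have : \sum_(i | i != q) E i <= \sum_(i : gV G | i != q) d.
  by apply: ler_sum => i ne_iq; rewrite EneE //; apply/ltW/ltz_pmod.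
by move: (E q) (\sum_(i | i != q) E i) (\sum_(i | i != q) d) => e S T; lia.
Qed.

Lemma grank_ge_ddeg (G : graph) : is_graph G ->
  exists C : int, forall D : divisor G, ddeg D - C <= grank D.
Proof.
move=> Gg; have [C win] := linsys_large_degree G Gg; exists C => D.
case: (leP 0 (ddeg D - C)) => [ge0|]; last by have := grank_geN1 _ D Gg; lia.
by apply/grank_geP => // E effE degE; apply: win; rewrite ddegB; lia.
Qed.

(* The divisor of the acyclic orientation given by the enumeration of the vertices. *)
Definition acyclic_divisor (G : graph) : divisor G :=
  fun x => \sum_(w | (enum_rank w < enum_rank x)%N) (gm w x)%:Z - 1.

(** Each edge is counted once at its later endpoint, which makes the halving in [genus] exact. *)
Lemma sum_gm_even (G : graph) : is_graph G ->
  (\sum_(x : gV G) \sum_(y : gV G) gm x y =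
   (\sum_(x : gV G) \sum_(w | (enum_rank w < enum_rank x)%N) gm w x) * 2)%N.
Proof.
move=> [sym loopless _ _]; rewrite muln2 -addnn.
have {2}-> : (\sum_(x : gV G) \sum_(w | (enum_rank w < enum_rank x)%N) gm w x =
          \sum_(w : gV G) \sum_(x | (enum_rank w < enum_rank x)%N) gm w x)%N.
  by rewrite (exchange_big_dep predT).
rewrite -big_split /=; apply: eq_bigr => x _.
rewrite (bigID (fun y => (enum_rank y < enum_rank x)%N)) /=; congr (_ + _)%N.
  by apply: eq_bigr => y _; rewrite sym.
rewrite (bigD1 x) ?ltnn //= loopless add0n; apply: eq_bigl => y.
by rewrite -leqNgt [in RHS]ltn_neqAle andbC -(inj_eq enum_rank_inj) eq_sym.
Qed.

Lemma genus_acyclic (G : graph) : is_graph G -> ddeg (acyclic_divisor G) = genus G - 1.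
Proof.
move=> Gg; rewrite /ddeg /acyclic_divisor sumrB sumr_const /genus sum_gm_even // mulnK //.
rewrite natz addrK Posz_sum; congr (_ - _).
by apply: eq_bigr => x _; rewrite Posz_sum.
Qed.

(** Let [x] be the first vertex in the enumeration at which the firing script [c] is maximal. Each
    edge from an earlier vertex costs [x] at least one chip and no other edge brings any, so [x]
    ends with at most [-1] chips. *)
Lemma acyclic_unwinnable (G : graph) : is_graph G -> ~ linsys_nonempty (acyclic_divisor G).
Proof.
move=> Gg [E [effE [c eqc]]]; have [v _] := graph_vertex _ Gg.
pose z := [arg max_(i > v) c i]%O.
have max_z w : c w <= c z by rewrite /z; case: arg_maxP => // i _ /(_ w isT).
have cz : c z == c z by [].
pose x := [arg min_(i < z | c i == c z) enum_rank i]%N.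
have [cx min_x] : c x == c z /\ forall w, c w == c z -> (enum_rank x <= enum_rank w)%N.
  by rewrite /x; case: arg_minnP => // i ci mini; split.
have := effE x; apply/negP; rewrite -ltNge.
have -> : E x = acyclic_divisor G x + \sum_w c w * fire w x by rewrite -eqc addrC subrK.
rewrite firingE // (bigID (fun w => (enum_rank w < enum_rank x)%N)) /=.
have low : \sum_(w | (enum_rank w < enum_rank x)%N) (c w - c x) * (gm w x)%:Z <=
    \sum_(w | (enum_rank w < enum_rank x)%N) - (gm w x)%:Z.
  apply: ler_sum => w lt_w.
  have : c w != c z by apply/negP => /min_x; lia.
  by have := max_z w; move: cx => /eqP ->; nia.
have high : \sum_(w | ~~ (enum_rank w < enum_rank x)%N) (c w - c x) * (gm w x)%:Z <= 0.
  by apply: sumr_le0 => w _; move: cx => /eqP ->; have := max_z w; nia.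
rewrite sumrN in low; rewrite /acyclic_divisor.
set S1 := \sum_(_ | _) (_ - _) * _ in low *.
set S2 := \sum_(_ | ~~ _) _ in high *.
set S := \sum_(_ | _) _ in low *.
by lia.
Qed.

(** If [D - N] is equivalent to an effective [E], then [D - E] is equivalent to the unwinnable [N].
    Thus [E], of degree [ddeg D - genus G + 1], is an obstruction. *)
Lemma grank_large_degree (G : graph) : is_graph G ->
  exists C : int, forall D : divisor G, C <= ddeg D -> grank D <= ddeg D - genus G.
Proof.
move=> Gg; have [C win] := linsys_large_degree G Gg.
exists (C + genus G) => D le_D; pose N := acyclic_divisor G.
have [|E [effE eqE]] := win (fun x => D x - N x).
  by rewrite ddegB genus_acyclic //; lia.
have degE : ddeg E = ddeg D - genus G + 1.
  by rewrite (ddeg_equiv _ _ _ Gg eqE) ddegB genus_acyclic //; ring.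
suff: grank D < ddeg E by rewrite degE; lia.
apply: grank_lt => // DE; apply: (acyclic_unwinnable G Gg).
apply: linsys_equiv DE; have [c eqc] := lin_equiv_sym _ _ _ eqE.
by exists c => x; rewrite -eqc /N; ring.
Qed.

(** * Vertex gluing *)

Definition gluing_maps (A B C : tmgraph) (f : gV (tg A) -> gV (tg C))
    (h : gV (tg B) -> gV (tg C)) : Prop :=
  injective f /\ injective h /\
  f (tv A) = h (tu B) /\
  (forall x y, f x = h y -> x = tv A) /\
  (forall z, (exists x, f x = z) \/ (exists y, h y = z)) /\
  (forall x x', gm (f x) (f x') = gm x x') /\
  (forall y y', gm (h y) (h y') = gm y y') /\
  (forall x y, x <> tv A -> y <> tu B ->
      gm (f x) (h y) = 0%N /\ gm (h y) (f x) = 0%N) /\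
  tu C = f (tu A) /\ tv C = h (tv B).

Lemma gluing_eq (A B C : tmgraph) f h x y : gluing_maps A B C f h ->
  (f x == h y) = (x == tv A) && (y == tu B).
Proof.
move=> [f_inj [h_inj [fh [only _]]]]; apply/eqP/andP => [e|[/eqP -> /eqP ->] //].
have xv := only _ _ e; split; first by apply/eqP.
by apply/eqP/h_inj; rewrite -fh -xv -e.
Qed.

Lemma gluing_big (R : Type) (idx : R) (op : Monoid.com_law idx) (A B C : tmgraph) f h
    (F : gV (tg C) -> R) : gluing_maps A B C f h ->
  \big[op/idx]_z F z =
  op (\big[op/idx]_x F (f x)) (\big[op/idx]_(y | y != tu B) F (h y)).
Proof.
move=> gl; have [f_inj [h_inj [fh [only [cover _]]]]] := gl.
rewrite (bigID (fun z => z \in f @: setT)) /=; congr (op _ _).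
  rewrite (big_imset F) => [|x x' _ _ /f_inj //].
  by apply: eq_bigl => x; rewrite inE.
have -> : \big[op/idx]_(y | y != tu B) F (h y) =
    \big[op/idx]_(y in [set y | y != tu B]) F (h y) by apply: eq_bigl => y; rewrite inE.
rewrite -(big_imset F) => [|y y' _ _ /h_inj //].
apply: eq_bigl => z; apply/negP/imsetP => [nz|[y + ->]].
  case: (cover z) => [[x xz]|[y yz]]; first by case: nz; apply/imsetP; exists x.
  exists y => //; rewrite inE; apply/negP => /eqP yu; case: nz; apply/imsetP.
  by exists (tv A) => //; rewrite -yz yu fh.
rewrite inE => ne_y /imsetP [x _ /esym /eqP].
by rewrite (gluing_eq _ _ _ _ _ _ _ gl) (negbTE ne_y) andbF.
Qed.

Lemma gluing_gm_fh (A B C : tmgraph) f h x y : gluing_maps A B C f h -> y != tu B ->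
  gm (f x) (h y) = (if x == tv A then gm (tu B) y else 0)%N.
Proof.
move=> [_ [_ [fh [_ [_ [_ [gmh [gm0 _]]]]]]]] /eqP ne_y.
by case: eqP => [->|ne_x]; [rewrite fh gmh | case: (gm0 _ _ ne_x ne_y)].
Qed.

Lemma gluing_gm_hf (A B C : tmgraph) f h x y : gluing_maps A B C f h -> y != tu B ->
  gm (h y) (f x) = (if x == tv A then gm y (tu B) else 0)%N.
Proof.
move=> [_ [_ [fh [_ [_ [_ [gmh [gm0 _]]]]]]]] /eqP ne_y.
by case: eqP => [->|ne_x]; [rewrite fh gmh | case: (gm0 _ _ ne_x ne_y)].
Qed.

Lemma connect_homo (T T' : finType) (e : rel T) (e' : rel T') (f : T -> T') (x y : T) :
  (forall a b, e a b -> e' (f a) (f b)) -> connect e x y -> connect e' (f x) (f y).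
Proof.
move=> homo /connectP [p + ->]; elim: p x => [|z p IH] x //= /andP [xz path_p].
exact: connect_trans (connect1 (homo _ _ xz)) (IH _ path_p).
Qed.

Lemma gluing_is_graph (A B C : tmgraph) f h : gluing_maps A B C f h ->
  is_graph (tg A) -> is_graph (tg B) -> is_graph (tg C).
Proof.
move=> gl [symA loopA VA connA] [symB loopB VB connB].
have [f_inj [h_inj [fh [only [cover [gmf [gmh _]]]]]]] := gl.
have cov z : (exists x, z = f x) \/ (exists y, z = h y /\ y != tu B).
  case: (cover z) => [[x <-]|[y <-]]; first by left; exists x.
  by case: (eqVneq y (tu B)) => [->|]; [left; exists (tv A) | right; exists y].
have symC (x y : gV (tg C)) : gm x y = gm y x.
  case: (cov x) (cov y) => [[x' ->]|[x' [-> nx]]] [[y' ->]|[y' [-> ny]]].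
  - by rewrite !gmf.
  - by rewrite (gluing_gm_fh _ _ _ _ _ _ _ gl) // (gluing_gm_hf _ _ _ _ _ _ _ gl) // symB.
  - by rewrite (gluing_gm_fh _ _ _ _ _ _ _ gl) // (gluing_gm_hf _ _ _ _ _ _ _ gl) // symB.
  - by rewrite !gmh.
split=> //.
- by move=> z; case: (cov z) => [[x ->]|[y [-> _]]]; rewrite ?gmf ?gmh.
- by apply/card_gt0P; exists (tv C).
have conn_sym : connect_sym (fun a b : gV (tg C) => (0 < gm a b)%N).
  by apply: sym_connect_sym => a b; rewrite symC.
have hub z : connect (fun a b : gV (tg C) => (0 < gm a b)%N) z (f (tv A)).
  case: (cov z) => [[x ->]|[y [-> _]]].
    by apply: connect_homo (connA x (tv A)) => a b; rewrite gmf.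
  by rewrite fh; apply: connect_homo (connB y (tu B)) => a b; rewrite gmh.
by move=> x y; apply: connect_trans (hub x) _; rewrite conn_sym.
Qed.

Lemma gluing_genus (A B C : tmgraph) f h : gluing_maps A B C f h ->
  is_graph (tg A) -> is_graph (tg B) -> genus (tg C) = genus (tg A) + genus (tg B).
Proof.
move=> gl Ag Bg; have [_ [_ [fh [_ [_ [gmf [gmh _]]]]]]] := gl.
have card : (#|gV (tg C)| + 1 = #|gV (tg A)| + #|gV (tg B)|)%N.
  rewrite -!sum1_card (gluing_big _ _ _ _ _ _ _ _ _ gl) -addnA; congr (_ + _)%N.
  by rewrite [RHS](bigD1 (tu B)) //= addnC.
have edges : (\sum_(x : gV (tg C)) \sum_y gm x y =
    \sum_(x : gV (tg A)) \sum_y gm x y + \sum_(x : gV (tg B)) \sum_y gm x y)%N.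
  rewrite (gluing_big _ _ _ _ _ _ _ _ _ gl) /=.
  under eq_bigr do rewrite (gluing_big _ _ _ _ _ _ _ _ _ gl) /=.
  under [X in (_ + X)%N]eq_bigr do rewrite (gluing_big _ _ _ _ _ _ _ _ _ gl) /=.
  rewrite big_split /= -addnA; congr (_ + _)%N.
    by apply: eq_bigr => x _; apply: eq_bigr => y _; rewrite gmf.
  rewrite [RHS](bigD1 (tu B)) //= [X in (_ = X + _)%N](bigD1 (tu B)) //=.
  have [_ -> _ _] := Bg; rewrite add0n; congr (_ + _)%N.
    rewrite (bigD1 (tv A)) //= [X in (_ + X)%N]big1 => [|x ne_x].
      by rewrite addn0; apply: eq_bigr => y ny; rewrite (gluing_gm_fh _ _ _ _ _ _ _ gl) ?eqxx.
    by apply: big1 => y ny; rewrite (gluing_gm_fh _ _ _ _ _ _ _ gl) // (negbTE ne_x).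
  apply: eq_bigr => y ny; rewrite [RHS](bigD1 (tu B)) //=; congr (_ + _)%N.
    rewrite (bigD1 (tv A)) //= big1 => [|x ne_x].
      by rewrite addn0 (gluing_gm_hf _ _ _ _ _ _ _ gl) ?eqxx.
    by rewrite (gluing_gm_hf _ _ _ _ _ _ _ gl) // (negbTE ne_x).
  by apply: eq_bigr => y' _; rewrite gmh.
rewrite /genus edges (sum_gm_even _ Ag) (sum_gm_even _ Bg) -mulnDl !mulnK //.
by lia.
Qed.

(** The chips at the node are assigned to the left side, so that the two restrictions add up to
    [D]. *)
Definition right_part (B C : tmgraph) (h : gV (tg B) -> gV (tg C))
    (D : divisor (tg C)) : divisor (tg B) :=
  fun y => if y == tu B then 0 else D (h y).

Lemma gluing_ddeg (A B C : tmgraph) f h (D : divisor (tg C)) : gluing_maps A B C f h ->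
  ddeg D = ddeg (fun x => D (f x)) + ddeg (right_part B C h D).
Proof.
move=> gl; rewrite /ddeg (gluing_big _ _ _ _ _ _ _ _ _ gl) /=; congr (_ + _).
rewrite [RHS](bigD1 (tu B)) //= {1}/right_part eqxx add0r.
by apply: eq_bigr => y ny; rewrite /right_part (negbTE ny).
Qed.

(** Edges cross between the sides only through the node: firing is local to a side away from it, and
    at the node the two contributions add. *)
Lemma gluing_firing_left (A B C : tmgraph) f h (c : gV (tg C) -> int) x :
  gluing_maps A B C f h -> is_graph (tg A) -> is_graph (tg C) -> x != tv A ->
  \sum_w c w * fire w (f x) = \sum_w c (f w) * fire w x.
Proof.
move=> gl Ag Cg nx; have [_ [_ [_ [_ [_ [gmf _]]]]]] := gl.
rewrite (firingE (tg C)) // (firingE (tg A)) // (gluing_big _ _ _ _ _ _ _ _ _ gl) /=.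
rewrite [X in _ + X]big1 ?addr0; first by apply: eq_bigr => w _; rewrite gmf.
by move=> y ny; rewrite (gluing_gm_hf _ _ _ _ _ _ _ gl) // (negbTE nx) mulr0.
Qed.

Lemma gluing_firing_right (A B C : tmgraph) f h (c : gV (tg C) -> int) y :
  gluing_maps A B C f h -> is_graph (tg B) -> is_graph (tg C) -> y != tu B ->
  \sum_w c w * fire w (h y) = \sum_w c (h w) * fire w y.
Proof.
move=> gl Bg Cg ny; have [_ [_ [fh [_ [_ [_ [gmh _]]]]]]] := gl.
rewrite (firingE (tg C)) // (firingE (tg B)) // (gluing_big _ _ _ _ _ _ _ _ _ gl) /=.
rewrite [RHS](bigD1 (tu B)) //=; congr (_ + _); last by apply: eq_bigr => w _; rewrite gmh.
rewrite (bigD1 (tv A)) //= (gluing_gm_fh _ _ _ _ _ _ _ gl) // eqxx fh big1 ?addr0 // => x nx.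
by rewrite (gluing_gm_fh _ _ _ _ _ _ _ gl) // (negbTE nx) mulr0.
Qed.

Lemma gluing_firing_node (A B C : tmgraph) f h (c : gV (tg C) -> int) :
  gluing_maps A B C f h -> is_graph (tg A) -> is_graph (tg B) -> is_graph (tg C) ->
  \sum_w c w * fire w (f (tv A)) =
  \sum_w c (f w) * fire w (tv A) + \sum_w c (h w) * fire w (tu B).
Proof.
move=> gl Ag Bg Cg; have [_ [_ [fh [_ [_ [gmf [gmh _]]]]]]] := gl.
rewrite (firingE (tg C)) // (firingE (tg A)) // (firingE (tg B)) //.
rewrite (gluing_big _ _ _ _ _ _ _ _ _ gl) /=; congr (_ + _).
  by apply: eq_bigr => w _; rewrite gmf.
rewrite [RHS](bigD1 (tu B)) //= subrr mul0r add0r.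
by apply: eq_bigr => w _; rewrite fh gmh.
Qed.

(* [r + 1] is the least degree of an effective divisor whose removal leaves an unwinnable
   divisor; two such obstructions, on either side of the node, glue to one on [C]. *)
Lemma gluing_grank (A B C : tmgraph) f h (D : divisor (tg C)) (b c : int) :
  gluing_maps A B C f h -> is_graph (tg A) -> is_graph (tg B) ->
  grank (fun z => D z - b * chip (tv C) z) + 1 <=
  (grank (fun x => D (f x) - c * chip (tv A) x) + 1) +
  (grank (twist (right_part B C h D) (c - 1) (tu B) (- b) (tv B)) + 1).
Proof.
move=> gl Ag Bg; have Cg := gluing_is_graph _ _ _ _ _ gl Ag Bg.
have [f_inj [h_inj [fh [only [cover [gmf [gmh [gm0 [uC vC]]]]]]]]] := gl.
have [E1 [eff1 <- no1]] := grank_obstruction _ (fun x => D (f x) - c * chip (tv A) x) Ag.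
have [E2 [eff2 <- no2]] :=
  grank_obstruction _ (twist (right_part B C h D) (c - 1) (tu B) (- b) (tv B)) Bg.
pose E z := \sum_(x | f x == z) E1 x + \sum_(y | h y == z) E2 y.
have effE : effective E by move=> z; apply: addr_ge0; apply: sumr_ge0.
have degE : ddeg E = ddeg E1 + ddeg E2.
  rewrite /ddeg big_split /=; congr (_ + _).
    by rewrite [RHS](partition_big f predT).
  by rewrite [RHS](partition_big h predT).
suff: grank (fun z => D z - b * chip (tv C) z) < ddeg E by rewrite degE; lia.
apply: grank_lt => // -[F [effF [g eqg]]].
have Ef x : x != tv A -> E (f x) = E1 x.
  move=> nx; rewrite /E (eq_bigl (pred1 x)) => [|x'] /=; last exact: inj_eq.
  rewrite big_pred1_eq big1 ?addr0 // => y; rewrite eq_sym (gluing_eq _ _ _ _ _ _ _ gl).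
  by rewrite (negbTE nx).
have Eh y : y != tu B -> E (h y) = E2 y.
  move=> ny; rewrite /E [X in _ + X](eq_bigl (pred1 y)) => [|y'] /=; last exact: inj_eq.
  rewrite big_pred1_eq big1 ?add0r // => x; rewrite (gluing_eq _ _ _ _ _ _ _ gl).
  by rewrite (negbTE ny) andbF.
have Enode : E (f (tv A)) = E1 (tv A) + E2 (tu B).
  rewrite /E; congr (_ + _).
    by rewrite (eq_bigl (pred1 (tv A))) ?big_pred1_eq // => x /=; apply: inj_eq.
  by rewrite fh (eq_bigl (pred1 (tu B))) ?big_pred1_eq // => x /=; apply: inj_eq.
have chip_h y : chip (tv C) (h y) = chip (tv B) y by rewrite /chip vC (inj_eq h_inj).
have chip_f x : x != tv A -> chip (tv C) (f x) = 0.
  by move=> nx; rewrite /chip vC (gluing_eq _ _ _ _ _ _ _ gl) (negbTE nx).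
(* The chips left at the node split into [alpha] from the left and [beta] from the right, the latter
   including the case where [tv C] is the node. Either [alpha >= c], or [alpha <= c - 1] and
   [beta >= 1 - c]; one of the two obstructions is contradicted. *)
pose alpha := D (f (tv A)) - E1 (tv A) + \sum_w g (f w) * fire w (tv A).
pose beta := - b * chip (tv B) (tu B) - E2 (tu B) + \sum_w g (h w) * fire w (tu B).
have sum_ge0 : 0 <= alpha + beta.
  have := effF (f (tv A)); have := eqg (f (tv A)).
  rewrite (gluing_firing_node _ _ _ _ _ _ gl) // Enode [in chip _ _]fh chip_h /alpha /beta.
  set S1 := \sum_w _; set S2 := \sum_w _; lia.
case: (leP c alpha) => [le_c|lt_c].
  apply: no1.
  exists (fun x => D (f x) - c * chip (tv A) x - E1 x + \sum_w g (f w) * fire w x).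
  split; last by exists (g \o f) => x /=; ring.
  move=> x; case: (eqVneq x (tv A)) => [->|nx].
    by rewrite {1}/chip eqxx mulr1; move: le_c; rewrite /alpha; set S := \sum_w _; lia.
  have := effF (f x); have := eqg (f x).
  rewrite (gluing_firing_left _ _ _ _ _ _ _ gl) // Ef // chip_f // /chip (negbTE nx).
  by set S := \sum_w _; lia.
apply: no2.
exists (fun y => twist (right_part B C h D) (c - 1) (tu B) (- b) (tv B) y - E2 y
                 + \sum_w g (h w) * fire w y).
split; last by exists (g \o h) => y /=; ring.
move=> y; rewrite /twist /right_part; case: (eqVneq y (tu B)) => [->|ny].
  rewrite {1}/chip eqxx mulr1; move: lt_c sum_ge0; rewrite /alpha /beta.
  by set S1 := \sum_w _; set S2 := \sum_w _; lia.
have := effF (h y); have := eqg (h y).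
rewrite (gluing_firing_right _ _ _ _ _ _ _ gl) // Eh // chip_h.
have -> : chip (tu B) y = 0 by rewrite /chip (negbTE ny).
by set S := \sum_w _; lia.
Qed.

(** * Transmission permutations of twice-marked graphs *)

Definition trank (T : tmgraph) (D : divisor (tg T)) (a b : int) : int :=
  grank (twist D a (tu T) (- b) (tv T)) + 1.

Lemma Delta_trank (T : tmgraph) (D : divisor (tg T)) (a b : int) : is_graph (tg T) ->
  Delta (tu T) (tv T) (twist D a (tu T) (- b) (tv T)) =
  trank T D a b - trank T D (a - 1) b - trank T D a (b + 1) + trank T D (a - 1) (b + 1).
Proof.
move=> Tg; rewrite /Delta /trank.
have tw (a' b' : int) : grank (twist (twist D a (tu T) (- b) (tv T)) a' (tu T) b' (tv T)) =
    grank (twist D (a + a') (tu T) (- b + b') (tv T)).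
  by apply: grank_ext => // x; rewrite /twist; ring.
rewrite !tw !addr0.
have -> : - (b + 1) = - b - 1 by ring.
ring.
Qed.

Lemma trank_rank_function (T : tmgraph) (k : nat) (D : divisor (tg T)) : is_graph (tg T) ->
  lin_equiv (kchip k (tu T)) (kchip k (tv T)) -> submodular (tu T) (tv T) D ->
  rank_function k (trank T D).
Proof.
move=> Tg eqk subm.
have chip_le (X Y : divisor (tg T)) w : (forall x, Y x = X x + chip w x) ->
    grank X + 1 <= grank Y + 1 <= grank X + 1 + 1.
  move=> YE; have effw : effective (chip w) by move=> x; rewrite /chip; case: ifP.
  rewrite (grank_ext _ Y (fun x => X x + chip w x)) //.
  by have := grank_add _ X _ Tg effw; rewrite ddeg_chip; lia.
split=> [a b|a b|a b|a b|].
- by apply: (chip_le _ _ (tv T)) => x; rewrite /twist; ring.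
- by apply: (chip_le _ _ (tu T)) => x; rewrite /twist; ring.
- have := subm a (- b); rewrite Delta_trank //.
  by move: (trank _ _ _ _) (trank _ _ _ _) (trank _ _ _ _) (trank _ _ _ _) => ? ? ? ?; lia.
- rewrite /trank; congr (_ + 1); apply: grank_equiv => //.
  have [c eqc] := eqk; exists c => x; rewrite -eqc /kchip /twist; ring.
have [C rank_ge] := grank_ge_ddeg (tg T) Tg.
exists (Num.max (ddeg D) (C - ddeg D)) => a b; rewrite /trank; split=> [lt_ab|].
  by rewrite grank_neg // ddeg_twist; lia.
by have := rank_ge (twist D a (tu T) (- b) (tv T)); rewrite ddeg_twist; lia.
Qed.

Lemma transmission_slipface (T : tmgraph) (k : nat) (D : divisor (tg T)) : is_graph (tg T) ->
  torsion_order T k -> general_transmission T k ->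
  exists (tau tau' : int -> int) (chi K : int),
    [/\ cancel tau tau' /\ cancel tau' tau,
        forall c : int, tau (c + k%:Z) = tau c + k%:Z,
        slipface tau (trank T D) chi K /\
        slipface (fun b => - tau' (- b)) (transpose (trank T D)) chi K,
        inv_le tau k (genus (tg T)) &
        chi <= ddeg D + 1 - genus (tg T)].
Proof.
move=> Tg [k_gt0 _ _] [eqk subm inv].
have [tau [tau' [chi [K [[tauK tauK'] per slip slip' DeltaE]]]]] :=
  rank_function_transmission _ _ k_gt0 (trank_rank_function _ _ D Tg eqk (subm D)).
exists tau, tau', chi, K; split=> //.
  apply: (inv D); split; first by exists tau'.
  by move=> a b; rewrite Delta_trank // DeltaE.
have [C rank_le] := grank_large_degree (tg T) Tg.
(* Here [a] is large enough for the linear formula and for the bound [r <= deg - g] to hold at once;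
   comparing them bounds [chi]. *)
have [_ _ big] := slip; pose a : int := Num.max K (C - ddeg D).
have := rank_le (twist D a (tu T) (- 0) (tv T)); have := big a 0.
rewrite /trank ddeg_twist; move: (grank _) => r.
by rewrite /a; lia.
Qed.

(** The bound [inv_le] applied to the empty family of inversions. *)
Lemma genus_ge0 (T : tmgraph) (k : nat) : is_graph (tg T) ->
  torsion_order T k -> general_transmission T k -> 0 <= genus (tg T).
Proof.
move=> Tg tors gt.
have [? [? [? [? [_ _ _ inv _]]]]] := transmission_slipface T k (fun=> 0) Tg tors gt.
exact: (inv [::]).
Qed.

Lemma transmission_left (T : tmgraph) (k : nat) (D : divisor (tg T)) (A : int -> int)
    (chiA m : int) : is_graph (tg T) -> torsion_order T k -> general_transmission T k ->
  maya A chiA m -> m + genus (tg T) < k%:Z ->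
  exists (M : int -> int) (chi : int), [/\ maya M chi (m + genus (tg T)),
    chi <= chiA + ddeg D - genus (tg T) &
    forall b : int, exists c : int, A c + trank T D (c - 1) b <= M b].
Proof.
move=> Tg tors gt Am lt_k; have g_ge0 := genus_ge0 _ _ Tg tors gt.
have [k_gt0 _ _] := tors.
have [tau [tau' [chi [K [[tauK tauK'] per [slip _] inv chi_le]]]]] :=
  transmission_slipface T k D Tg tors gt.
have bij : bijective tau by exists tau'.
move: inv lt_k; rewrite -(gez0_abs g_ge0) => inv lt_k.
have [M [Mm M_ge]] := maya_slipface _ _ _ _ _ _ _ _ _ k_gt0 bij per slip inv Am lt_k.
by exists M, (chiA + chi - 1); split=> //; lia.
Qed.

(** The mirror image of [transmission_left], obtained from the transposed slipface. The arguments
    [1 - c] and [1 - a] come from the node: [c] chips removed on one side face [c - 1] added on the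
    other. *)
Lemma transmission_right (T : tmgraph) (k : nat) (D : divisor (tg T)) (B : int -> int)
    (chiB m : int) : is_graph (tg T) -> torsion_order T k -> general_transmission T k ->
  maya B chiB m -> m + genus (tg T) < k%:Z ->
  exists (M : int -> int) (chi : int), [/\ maya M chi (m + genus (tg T)),
    chi <= chiB + ddeg D - genus (tg T) &
    forall a : int, exists c : int, trank T D (a - 1) c + B (1 - c) <= M (1 - a)].
Proof.
move=> Tg tors gt Bm lt_k; have g_ge0 := genus_ge0 _ _ Tg tors gt.
have [k_gt0 _ _] := tors.
have [tau [tau' [chi [K [[tauK tauK'] per [_ slip] inv chi_le]]]]] :=
  transmission_slipface T k D Tg tors gt.
have bij : bijective (fun b => - tau' (- b)).
  by exists (fun b => - tau (- b)) => b; rewrite opprK ?tauK ?tauK' opprK.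
have per' (c : int) : - tau' (- (c + k%:Z)) = - tau' (- c) + k%:Z.
  have := per (tau' (- c) - k%:Z); rewrite subrK tauK' => E.
  have -> : - (c + k%:Z) = tau (tau' (- c) - k%:Z) by lia.
  by rewrite tauK; ring.
have {}inv := inv_le_transpose _ _ _ _ tauK' per inv.
move: inv lt_k; rewrite -(gez0_abs g_ge0) => inv lt_k.
have [M [Mm M_ge]] := maya_slipface _ _ _ _ _ _ _ _ _ k_gt0 bij per' slip inv Bm lt_k.
exists M, (chiB + chi - 1); split=> [//||a]; first by lia.
have [c le_c] := M_ge (1 - a); exists (1 - c).
move: le_c; rewrite /transpose !opprB addrC.
by have -> : 1 + (c - 1) = c by ring.
Qed.

(** * Chains *)

Definition chain_of (l : nat) (Gs : nat -> tmgraph) (ks : nat -> nat)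
    (Hs : nat -> tmgraph) : Prop :=
  [/\ forall i, (i < l)%N -> is_graph (tg (Gs i)),
      forall i, (i < l)%N -> torsion_order (Gs i) (ks i),
      forall i, (i < l)%N -> general_transmission (Gs i) (ks i),
      Hs 0%N = Gs 0%N &
      forall i, (i.+1 < l)%N -> is_vertex_gluing (Hs i) (Gs i.+1) (Hs i.+1)].

Lemma chain_graph_genus (l : nat) (Gs : nat -> tmgraph) (ks : nat -> nat)
    (Hs : nat -> tmgraph) (j : nat) : chain_of l Gs ks Hs -> (j < l)%N ->
  is_graph (tg (Hs j)) /\ genus (tg (Hs j)) = \sum_(i < j.+1) genus (tg (Gs i)).
Proof.
move=> [Gg _ _ H0 glue]; elim: j => [|j IH] lt_j.
  by rewrite H0 big_ord_recl big_ord0 addr0; split=> //; apply: Gg.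
have [Hg genusH] := IH (ltnW lt_j); have [f [h gl]] := glue _ lt_j.
split; first by apply: gluing_is_graph gl Hg (Gg _ lt_j).
by rewrite (gluing_genus _ _ _ _ _ gl Hg (Gg _ lt_j)) genusH [RHS]big_ord_recr.
Qed.

(** Induction along the chain: gluing bounds the new rank function by a min-plus product, and the
    new graph adds at most its genus in boxes. *)
Lemma left_chain (l : nat) (Gs : nat -> tmgraph) (ks : nat -> nat)
    (Hs : nat -> tmgraph) (j : nat) : chain_of l Gs ks Hs -> (j < l)%N ->
  (forall i, (i <= j)%N -> \sum_(n < i.+1) genus (tg (Gs n)) < (ks i)%:Z) ->
  forall D : divisor (tg (Hs j)), exists (M : int -> int) (chi : int),
    [/\ maya M chi (\sum_(n < j.+1) genus (tg (Gs n))),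
        chi <= 1 + ddeg D - \sum_(n < j.+1) genus (tg (Gs n)) &
        forall b : int, grank (fun z => D z - b * chip (tv (Hs j)) z) + 1 <= M b].
Proof.
move=> ch; have [Gg tors gt H0 glue] := ch; elim: j => [|j IH] lt_j lt_k D.
  have := lt_k 0%N (leqnn _); move: D; rewrite H0 big_ord_recl big_ord0 addr0 => D lt_k0.
  have Hg := Gg _ lt_j.
  (* [maya_ramp 1] is the counting function of a single point, seen as glued to the left of the
     first graph. *)
  have [|M [chi [Mm chi_le M_ge]]] := transmission_left _ _ D _ _ _ Hg (tors _ lt_j)
    (gt _ lt_j) (maya_ramp 1); first by rewrite add0r.
  exists M, chi; split=> [||b]; rewrite ?add0r // in Mm *.
  have [c] := M_ge b; apply: le_trans; rewrite /trank.
  pose X z := D z - b * chip (tv (Gs 0%N)) z.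
  have tw (a : int) : grank (twist D a (tu (Gs 0%N)) (- b) (tv (Gs 0%N))) =
      grank (fun z => X z + a * chip (tu (Gs 0%N)) z).
    by apply: grank_ext => // z; rewrite /X /twist; ring.
  (* Adding chips cannot lower the rank, while removing [1 - c] of them costs at most [1 - c], the
     value of the ramp at [c]. *)
  rewrite tw -/X; case: (leP 0 (c - 1)) => c_ge.
    have := grank_add _ X _ Hg (effective_chipZ _ (tu (Gs 0%N)) _ c_ge); lia.
  have eff : effective (fun z => (1 - c) * chip (tu (Gs 0%N)) z).
    by apply: effective_chipZ; lia.
  have := grank_add _ (fun z => X z + (c - 1) * chip (tu (Gs 0%N)) z) _ Hg eff.
  rewrite ddegZ ddeg_chip mulr1 => /andP [_].
  rewrite (grank_ext _ (fun x => _ + _ + _) X) // => [|z]; last by ring.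
  by lia.
have [Hg _] := chain_graph_genus _ _ _ _ _ ch (ltnW lt_j).
have [f [h gl]] := glue _ lt_j.
have [|A [chiA [Am chiA_le A_ge]]] := IH (ltnW lt_j) _ (fun x => D (f x)).
  by move=> i le_i; apply: lt_k; lia.
pose D2 := right_part (Gs j.+1) (Hs j.+1) h D.
have [|M [chi [Mm chi_le M_ge]]] := transmission_left _ _ D2 _ _ _ (Gg _ lt_j) (tors _ lt_j)
    (gt _ lt_j) Am.
  by have := lt_k j.+1 (leqnn _); rewrite big_ord_recr.
exists M, chi; split=> [||b].
- by rewrite big_ord_recr.
- rewrite big_ord_recr /= (gluing_ddeg _ _ _ _ _ D gl) -/D2.
  by move: chi_le chiA_le; set S := \sum_(_ < _) _; lia.
have [c le_c] := M_ge b; apply: le_trans le_c.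
apply: le_trans (gluing_grank _ _ _ _ _ D b c gl Hg (Gg _ lt_j)) _.
by apply: lerD.
Qed.

(** Induction from the far end, [n] being the number of graphs already absorbed into [B]. The
    remaining divisor [D'] lives on the initial chain [Hs j], and the inequality for all [c] is what
    [left_chain] can later be paired with. *)
Lemma right_chain (l : nat) (Gs : nat -> tmgraph) (ks : nat -> nat)
    (Hs : nat -> tmgraph) (L : nat) (D : divisor (tg (Hs L))) :
  chain_of l Gs ks Hs -> L.+1 = l -> forall n j, (j + n)%N = L ->
  (forall i, (j < i < l)%N -> \sum_(i <= i' < l) genus (tg (Gs i')) < (ks i)%:Z) ->
  exists (D' : divisor (tg (Hs j))) (B : int -> int) (chi : int),
    [/\ maya B chi (\sum_(j.+1 <= i < l) genus (tg (Gs i))),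
        chi <= 1 + ddeg D - ddeg D' - \sum_(j.+1 <= i < l) genus (tg (Gs i)) &
        forall c : int, grank D + 1 <=
          grank (fun z => D' z - c * chip (tv (Hs j)) z) + 1 + B (1 - c)].
Proof.
move=> ch def_l; have [Gg tors gt H0 glue] := ch.
elim=> [|n IH] j jn lt_k.
  rewrite addn0 in jn; rewrite jn in lt_k *.
  have [Hg _] := chain_graph_genus _ _ _ _ L ch ltac:(lia).
  exists D, (fun b => Num.max 0 (1 - b)), 1; rewrite big_geq; last by lia.
  split=> [||c]; [exact: maya_ramp | by lia |].
  have -> : 1 - (1 - c) = c by ring.
  case: (leP c 0) => c_le.
    have eff : effective (fun z => (- c) * chip (tv (Hs L)) z).
      by apply: effective_chipZ; lia.
    have := grank_add _ D _ Hg eff.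
    rewrite (grank_ext _ (fun x => D x + _) (fun z => D z - c * chip (tv (Hs L)) z)) //.
      by lia.
    by move=> z; ring.
  have := grank_add _ (fun z => D z - c * chip (tv (Hs L)) z) _ Hg
    (effective_chipZ _ (tv (Hs L)) _ (ltW c_le)).
  rewrite ddegZ ddeg_chip mulr1 (grank_ext _ (fun x => _ - _ + _) D) // => [|z]; last by ring.
  by lia.
have lt_j : (j.+1 < l)%N by lia.
have [|i lt_i|D' [B [chiB [Bm chiB_le B_ge]]]] := IH j.+1.
- by lia.
- by apply: lt_k; lia.
have [Hg _] := chain_graph_genus _ _ _ _ _ ch (ltnW lt_j).
have [f [h gl]] := glue _ lt_j.
pose D2 := right_part (Gs j.+1) (Hs j.+1) h D'.
have sumE : \sum_(j.+1 <= i < l) genus (tg (Gs i)) =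
    \sum_(j.+2 <= i < l) genus (tg (Gs i)) + genus (tg (Gs j.+1)).
  by rewrite big_ltn // addrC.
have [|M [chi [Mm chi_le M_ge]]] := transmission_right _ _ D2 _ _ _ (Gg _ lt_j) (tors _ lt_j)
    (gt _ lt_j) Bm.
  by rewrite -sumE; apply: lt_k; lia.
exists (fun x => D' (f x)), M, chi; split=> [||a].
- by rewrite sumE.
- move: chiB_le chi_le; rewrite sumE (gluing_ddeg _ _ _ _ _ D' gl) -/D2.
  by set S := \sum_(_ <= _ < _) _; lia.
have [c le_c] := M_ge a; apply: le_trans (B_ge c) _.
have := gluing_grank _ _ _ _ _ D' c a gl Hg (Gg _ lt_j).
rewrite -/D2 -/(trank _ D2 _ _); move: le_c.
move: (trank _ _ _ _) (B _) (M _) (grank _) (grank _) => x1 x2 x3 x4 x5; lia.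
Qed.

(** * From partitions to the Brill-Noether inequalities *)

Lemma sidx_spec (G : graph) (D : divisor G) (v : gV G) (i : nat) : is_graph G ->
  i%:Z <= grank (twist D (sidx D v i) v 0 v).
Proof.
move=> Gg; suff least : exists z : int, i%:Z <= grank (twist D z v 0 v) /\
    forall y : int, i%:Z <= grank (twist D y v 0 v) -> z <= y.
  by have [] := epsilon_spec (inhabits (0 : int)) _ least.
have [C rank_ge] := grank_ge_ddeg _ Gg.
apply: (@int_least _ (- ddeg D) (i%:Z + C - ddeg D)).
  by have := rank_ge (twist D (i%:Z + C - ddeg D) v 0 v); rewrite ddeg_twist; lia.
move=> z le_i; case: leP => // lt_z; move: le_i.
by rewrite grank_neg // ddeg_twist; lia.
Qed.

(** Row [i] of the diagram reaches at least column [- sidx D v i], so it has at least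
    [wlambda D v i] boxes. *)
Lemma maya_bn_marked (G : graph) (v : gV G) (D : divisor G) (M : int -> int) (chi : int)
    (N : nat) : is_graph G -> maya M chi (genus G) -> chi <= 1 + ddeg D - genus G ->
  (forall b : int, grank (fun z => D z - b * chip v z) + 1 <= M b) ->
  \sum_(i < N) wlambda D v i <= genus G.
Proof.
move=> Gg Mm chi_le M_ge.
apply: le_trans (maya_sum _ _ _ (fun i => - sidx D v i) N Mm _); last first.
  move=> i _; apply: le_trans (M_ge _); rewrite lerD2r.
  apply: le_trans (sidx_spec _ D v i Gg) _.
  by rewrite (grank_ext _ _ (fun z => D z - - sidx D v i * chip v z)) // => z; rewrite /twist; ring.
by apply: ler_sum => i _; rewrite /wlambda; lia.
Qed.

(* [lambda_i + mu_{r-i} >= g - d + r] for the two partitions, summed over [0 <= i <= r]. *)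
Lemma maya_pair (ML MR : int -> int) (chiL chiR mL mR : int) (n : nat) :
  maya ML chiL mL -> maya MR chiR mR ->
  (forall c : int, n%:Z <= ML c + MR (1 - c)) ->
  n%:Z * (n%:Z + 1 - chiL - chiR) <= mL + mR.
Proof.
move=> Lm Rm LR; have last_c (i : nat) := maya_last _ _ _ i Lm.
pose c (i : nat) := proj1_sig (constructive_indefinite_description _ (last_c i)).
have cP i : i%:Z + 1 <= ML (c i) /\ ML (c i + 1) <= i%:Z.
  by rewrite /c; case: constructive_indefinite_description.
have sumL := maya_sum _ _ _ c n Lm (fun i _ => (cP i).1).
(* Just after the last column [c] of row [n - 1 - i] on the left, [ML] is at most [n - 1 - i], so
   [MR] is at least [i + 1] at [- c]. The columns cancel when these rows are paired. *)
have sumR : \sum_(i < n) (i%:Z + 1 - chiR - c (n - i.+1)%N) <= mR.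
  apply: (maya_sum _ _ _ (fun i => - c (n - i.+1)%N) n Rm) => i lt_i.
  have [_] := cP (n - i.+1)%N; have := LR (c (n - i.+1)%N + 1).
  have -> : 1 - (c (n - i.+1)%N + 1) = - c (n - i.+1)%N by ring.
  by lia.
rewrite (reindex_inj rev_ord_inj) /= in sumR.
apply: le_trans (lerD sumL sumR); rewrite -big_split /=.
rewrite (eq_bigr (fun=> n%:Z + 1 - chiL - chiR)) => [|i _].
  by rewrite sumr_const card_ord -mulr_natl natz.
have -> : (n - (n - i.+1).+1)%N = i by have := ltn_ord i; lia.
by have := ltn_ord i; lia.
Qed.

(** Prefix sums increase and suffix sums decrease, so the minimum switches sides at most once; the
    cut is just before the first index whose suffix sum is the smaller, or at the end. *)
Lemma chain_split (l : nat) (g : nat -> int) (ks : nat -> nat) : (0 < l)%N ->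
  (forall i, (i < l)%N -> 0 <= g i) ->
  (forall i, (i < l)%N ->
    Num.min (\sum_(j < i.+1) g j) (\sum_(i <= j < l) g j) < (ks i)%:Z) ->
  exists m, [/\ (m < l)%N,
    forall i, (i <= m)%N -> \sum_(j < i.+1) g j < (ks i)%:Z &
    forall i, (m < i < l)%N -> \sum_(i <= j < l) g j < (ks i)%:Z].
Proof.
move=> l_gt0 g_ge0 lt_k.
pose P i := \sum_(j < i.+1) g j; pose Q i := \sum_(i <= j < l) g j.
have nat_ge0 a b : (b <= l)%N -> 0 <= \sum_(a <= j < b) g j.
  move=> le_b; rewrite big_nat; apply: sumr_ge0 => j /andP [_ lt_j].
  by apply: g_ge0; apply: leq_trans lt_j le_b.
have P_mono i i' : (i <= i')%N -> (i' < l)%N -> P i <= P i'.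
  move=> le_i lt_i'; rewrite /P -!(big_mkord xpredT g).
  by rewrite (@big_cat_nat _ _ _ i.+1 0 i'.+1) //= lerDl nat_ge0.
have Q_anti i i' : (i <= i')%N -> (i' < l)%N -> Q i' <= Q i.
  move=> le_i lt_i'; rewrite /Q (@big_cat_nat _ _ _ i' i l) //=; last exact: ltnW.
  by rewrite lerDr nat_ge0 // ltnW.
have PQ0 : P 0%N <= Q 0%N.
  by rewrite /P /Q -(big_mkord xpredT g) (@big_cat_nat _ _ _ 1 0 l) //= lerDl nat_ge0.
case: (classic (exists i, (i < l)%N && (Q i < P i))) => [ex|no].
  have [i0 /andP [lt_i0 QP0] min_i0] := ex_minnP ex.
  have i0_gt0 : (0 < i0)%N by case: i0 QP0 {lt_i0 min_i0} => // ; lia.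
  exists i0.-1; split=> [|i le_i|i /andP [gt_i lt_i]]; first by lia.
    have lt_i : (i < l)%N by lia.
    have := lt_k i lt_i; rewrite -/(P i) -/(Q i).
    have := min_i0 i; rewrite lt_i /=; case: (ltP (Q i) (P i)) => [_ /(_ isT)|]; lia.
  have := lt_k i lt_i; rewrite -/(P i) -/(Q i).
  have := P_mono i0 i ltac:(lia) lt_i; have := Q_anti i0 i ltac:(lia) lt_i.
  by lia.
exists l.-1; split=> [|i le_i|i]; try lia.
have lt_i : (i < l)%N by lia.
have := lt_k i lt_i; rewrite -/(P i) -/(Q i); case: (ltP (Q i) (P i)) => [lt_QP|]; last by lia.
by case: no; exists i; rewrite lt_i.
Qed.

Theorem theorem1p3 (l : nat) (Gs : nat -> tmgraph) (ks : nat -> nat)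
  (Hs : nat -> tmgraph) :
  (0 < l)%N ->
  (forall i, (i < l)%N -> is_graph (tg (Gs i))) ->
  (forall i, (i < l)%N -> torsion_order (Gs i) (ks i)) ->
  (forall i, (i < l)%N -> general_transmission (Gs i) (ks i)) ->
  Hs 0%N = Gs 0%N ->
  (forall i, (i.+1 < l)%N -> is_vertex_gluing (Hs i) (Gs i.+1) (Hs i.+1)) ->
  ((forall i, (i < l)%N ->
      \sum_(j < i.+1) genus (tg (Gs j)) < (ks i)%:Z) ->
    bn_general_marked (tv (Hs l.-1))) /\
  ((forall i, (i < l)%N ->
      Num.min (\sum_(j < i.+1) genus (tg (Gs j)))
              (\sum_(i <= j < l) genus (tg (Gs j))) < (ks i)%:Z) ->
    bn_general (tg (Hs l.-1))).
Proof.
move=> l_gt0 Gg tors gt H0 glue.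
have ch : chain_of l Gs ks Hs by split.
have lt_l : (l.-1 < l)%N by lia.
have [Hg genusH] := chain_graph_genus _ _ _ _ _ ch lt_l.
split=> [lt_k D N|lt_k D r r_ge0 r_le].
  have [|M [chi [Mm chi_le M_ge]]] := left_chain _ _ _ _ _ ch lt_l _ D.
    by move=> i le_i; apply: lt_k; lia.
  rewrite -genusH in Mm chi_le.
  exact: maya_bn_marked Hg Mm chi_le M_ge.
have g_ge0 i : (i < l)%N -> 0 <= genus (tg (Gs i)).
  by move=> lt_i; apply: genus_ge0 (Gg _ lt_i) (tors _ lt_i) (gt _ lt_i).
have [m [lt_m lt_kL lt_kR]] := chain_split l _ ks l_gt0 g_ge0 lt_k.
have [|D' [B [chiR [Bm chiR_le B_ge]]]] :=
  right_chain _ _ _ _ _ D ch (prednK l_gt0) (l.-1 - m)%N m _ lt_kR; first by lia.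
have [M [chiL [Mm chiL_le M_ge]]] := left_chain _ _ _ _ _ ch lt_m lt_kL D'.
(* Here [n = r + 1], and the degree of [D'] cancels in [chiL + chiR <= 2 + ddeg D - genus], so
   [n + 1 - chiL - chiR] is at least [g - d + r]. *)
have LR (c : int) : (`|r|.+1)%N%:Z <= M c + B (1 - c).
  by have := B_ge c; have := M_ge c; lia.
have := maya_pair _ _ _ _ _ _ _ Mm Bm LR.
have sumE : \sum_(n < m.+1) genus (tg (Gs n)) + \sum_(m.+1 <= i < l) genus (tg (Gs i)) =
    genus (tg (Hs l.-1)).
  rewrite genusH prednK // -!(big_mkord xpredT (fun i => genus (tg (Gs i)))).
  by rewrite [RHS](@big_cat_nat _ _ _ m.+1).
move: chiL_le chiR_le sumE; set SL := \sum_(_ < _) _; set SR := \sum_(_ <= _ < _) _.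
move=> chiL_le chiR_le <-; rewrite (_ : (`|r|.+1)%N%:Z = r + 1); last by lia.
move=> le_g; rewrite subr_ge0; apply: le_trans le_g.
by apply: ler_wpM2l; lia.
Qed.
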